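(* Let $d\ge1$, $\mu\in\mathbb{R}^d$, $A$ a $d\times d$ symmetric positive definite matrix and $R$ a $d\times d$ reflection nonsingular $\mathcal{M}$-matrix. Fix a nonempty subset $J\subseteq\{1,\dots,d\}$. Suppose that for every $I$ with $J\subseteq I\subseteq\{1,\dots,d\}$ the process $\mathrm{SRBM}^{|I|}([R]_I,[\mu]_I,[A]_I)$ does not hit the corner. Then $\mathrm{SRBM}^d(R,\mu,A)$ does not hit the edge $S_J$.
   Context: For $I=\{i_1<\dots<i_m\}\subseteq\{1,\dots,d\}$: $[x]_I=(x_{i_1},\dots,x_{i_m})'$ and $[C]_I=(c_{i_ki_l})_{1\le k,l\le m}$ for a $d\times d$ matrix $C$. Let $S=\mathbb{R}^d_+$ and $S_I=\{x\in S: x_i=0\ \forall i\in I\}$. A $d\times d$ matrix $R$ is a reflection nonsingular $\mathcal{M}$-matrix if $r_{ii}=1$, $r_{ij}\le 0$ for $i\ne j$ and the spectral radius of $I_d-R$ is less than $1$. $\mathrm{SRBM}^d(R,\mu,A)$ started at $z\in S$: a continuous adapted $S$-valued process $Z=B+RL$, where $B$ is a Brownian motion with drift $\mu$, covariance $A$, $B(0)=z$, and $L=(L_1,\dots,L_d)'$ continuous adapted, each $L_k$ nondecreasing, $L_k(0)=0$, $\int_0^\infty Z_k\,dL_k=0$; for reflection nonsingular $\mathcal{M}$-matrices it exists and is pathwise unique for all $z$. It does not hit $S_I$ if $\mathbb{P}_z(\exists t>0:Z(t)\in S_I)=0$ for every $z\in S$; not hitting the corner means not hitting $S_{\{1,\dots,d\}}=\{0\}$.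 *)

(* Defs.v *)
From HB Require Import structures.
From mathcomp Require Import all_boot all_order all_algebra.
From mathcomp Require Import all_classical all_reals all_analysis.
From mathcomp Require Import complex.
Set Implicit Arguments. Unset Strict Implicit. Unset Printing Implicit Defensive.
Import Order.TTheory GRing.Theory Num.Theory.
Import numFieldNormedType.Exports.
Local Open Scope classical_set_scope.
Local Open Scope ring_scope.

(** Column vectors of R^n are ['cV[R]_n]; indices {1..n} are rendered as ['I_n]
    (0-based).  Time ranges over [0, +oo[ in R. *)

(** [x]_I : the subvector (x_{i_1},...,x_{i_m})' with i_1 < ... < i_m the
    elements of I (enum of a set of ordinals is increasing). *)
Definition subvec (R : realType) (n : nat) (I : {set 'I_n}) (x : 'cV[R]_n)
  : 'cV[R]_#|I| := \col_(k < #|I|) x (enum_val k) 0.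

Definition submx_I (R : realType) (n : nat) (I : {set 'I_n}) (C : 'M[R]_n)
  : 'M[R]_#|I| := \matrix_(k < #|I|, l < #|I|) C (enum_val k) (enum_val l).

Definition orthant (R : realType) (n : nat) : set 'cV[R]_n :=
  [set x | forall i, 0 <= x i 0].

Definition face (R : realType) (n : nat) (I : {set 'I_n}) : set 'cV[R]_n :=
  [set x | orthant x /\ forall i, i \in I -> x i 0 = 0].

Definition sym_pos_def (R : realType) (n : nat) (A : 'M[R]_n) : Prop :=
  A^T = A /\ forall v : 'cV[R]_n, v != 0 -> 0 < (v^T *m A *m v) 0 0.

Definition spectral_radius_lt1 (R : realType) (n : nat) (Q : 'M[R]_n) : Prop :=
  forall l : R[i], root (char_poly (map_mx (fun x => Complex x 0) Q)) l ->
    `|l| < 1.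

Definition reflection_M_matrix (R : realType) (n : nat) (Rm : 'M[R]_n) : Prop :=
  [/\ forall i, Rm i i = 1,
      forall i j, i != j -> Rm i j <= 0
    & spectral_radius_lt1 (1%:M - Rm)].

Definition filtration (R : realType) (dT : measure_display) (T : measurableType dT)
  (F : R -> set (set T)) : Prop :=
  [/\ forall t, sigma_algebra setT (F t),
      forall t, F t `<=` measurable
    & forall s t, 0 <= s -> s <= t -> F s `<=` F t].

Definition measurable_wrt (R : realType) (T : Type) (G : set (set T)) (X : T -> R)
  : Prop :=
  forall U : set R, measurable U -> G (X @^-1` U).

Definition cont_adapted (R : realType) (dT : measure_display) (T : measurableType dT)
  (n : nat) (F : R -> set (set T)) (X : R -> T -> 'cV[R]_n) : Prop :=
  (forall w i, {within [set t : R | 0 <= t], continuous (fun t : R => X t w i 0)}) /\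
  (forall t i, 0 <= t -> measurable_wrt (F t) (fun w => X t w i 0)).

Definition incr_event (R : realType) (T : Type) (n : nat)
  (B : R -> T -> 'cV[R]_n) (s t : R) (U : 'I_n -> set R) : set T :=
  [set w | forall i, U i ((B t w - B s w) i 0)].

(** B is an (F_t)-Brownian motion in R^n with drift mu, covariance A, B(0) = z:
    continuous adapted paths, and for 0 <= s < t the increment B(t) - B(s) is
    independent of F_s (product rule on F_s-events and Borel rectangles, which
    form a generating pi-system) and multivariate normal with mean (t-s) mu and
    covariance (t-s) A (every nonzero linear functional v' (B t - B s) is
    N((t-s) v'mu, (t-s) v'Av)). *)
Definition brownian_motion (R : realType) (dT : measure_display)
  (T : measurableType dT) (P : probability T R) (n : nat)
  (F : R -> set (set T)) (B : R -> T -> 'cV[R]_n)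
  (mu : 'cV[R]_n) (A : 'M[R]_n) (z : 'cV[R]_n) : Prop :=
  [/\ forall w, B 0 w = z,
      cont_adapted F B,
      (forall s t (v : 'cV[R]_n), 0 <= s -> s < t -> v != 0 ->
        forall U : set R, measurable U ->
          P ((fun w => (v^T *m (B t w - B s w)) 0 0) @^-1` U) =
          normal_prob ((t - s) * (v^T *m mu) 0 0)
                      (Num.sqrt ((t - s) * (v^T *m A *m v) 0 0)) U)
    & (forall s t, 0 <= s -> s < t ->
        forall (E : set T) (U : 'I_n -> set R), F s E ->
          (forall i, measurable (U i)) ->
          P (E `&` incr_event B s t U) = (P E * P (incr_event B s t U))%E)].

(** Stieltjes integral condition  int_0^oo Y(t) dL(t) = 0  for a continuous
    nondecreasing L with L(0) = 0: L (extended by L(0) on t < 0) is a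
    cumulative function and the integral of Y on [0,+oo[ against the
    associated Lebesgue-Stieltjes measure vanishes. *)
Definition stieltjes_int0 (R : realType) (Y L : R -> R) : Prop :=
  exists f : cumulative R R,
    (forall t, f t = L (Num.max t 0)) /\
    (\int[lebesgue_stieltjes_measure f]_(t in [set t : R | 0 <= t]%R) (Y t)%:E = 0)%E.

Definition is_SRBM (R : realType) (dT : measure_display) (T : measurableType dT)
  (P : probability T R) (n : nat) (F : R -> set (set T)) (Z : R -> T -> 'cV[R]_n)
  (Rm : 'M[R]_n) (mu : 'cV[R]_n) (A : 'M[R]_n) (z : 'cV[R]_n) : Prop :=
  exists (B L : R -> T -> 'cV[R]_n),
    [/\ brownian_motion P F B mu A z,
        cont_adapted F Z,
        (forall t w, 0 <= t -> orthant (Z t w)),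
        (forall t w, 0 <= t -> Z t w = B t w + Rm *m L t w)
      & cont_adapted F L /\ forall w k,
          [/\ L 0 w k 0 = 0,
              (forall s t, 0 <= s -> s <= t -> L s w k 0 <= L t w k 0)
            & stieltjes_int0 (fun t => Z t w k 0) (fun t => L t w k 0)]].

Definition SRBM_not_hit (R : realType) (n : nat) (Rm : 'M[R]_n) (mu : 'cV[R]_n)
  (A : 'M[R]_n) (I : {set 'I_n}) : Prop :=
  forall (dT : measure_display) (T : measurableType dT) (P : probability T R)
    (F : R -> set (set T)) (Z : R -> T -> 'cV[R]_n) (z : 'cV[R]_n),
    filtration F -> orthant z -> is_SRBM P F Z Rm mu A z ->
    P.-negligible [set w | exists t, 0 < t /\ face I (Z t w)].

Definition SRBM_not_hit_corner (R : realType) (n : nat) (Rm : 'M[R]_n)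
  (mu : 'cV[R]_n) (A : 'M[R]_n) : Prop :=
  SRBM_not_hit Rm mu A [set: 'I_n]%SET.

(* Main.v *)
Require Import Defs.
From HB Require Import structures.
From mathcomp Require Import all_boot all_order all_algebra.
From mathcomp Require Import all_classical all_reals all_analysis.
From mathcomp Require Import measurable_realfun complex.
From mathcomp Require Import ring lra.
Set Implicit Arguments. Unset Strict Implicit. Unset Printing Implicit Defensive.
Import Order.TTheory GRing.Theory Num.Theory.
Import numFieldNormedType.Exports.
Local Open Scope classical_set_scope.
Local Open Scope ring_scope.

(** Suppose Z(t) lies in S_J with t > 0, and let I, which contains J, be the
    set of all coordinates of Z vanishing at time t.  By continuity there is a
    rational q < t such that the coordinates outside I are positive on [q, t];
    their regulators are then constant on [q, t], so on this interval [Z]_I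
    solves the Skorokhod problem for [R]_I driven by the increments of [B]_I
    after q, started at [Z(q)]_I.  By uniqueness it coincides there with the
    reflected process Y obtained by solving this Skorokhod problem on all of
    [0, +oo[, and Y hits the corner.  The increments of B after q being
    independent of F_q, Fubini's theorem reduces the starting point to a
    deterministic one, for which Y is an SRBM([R]_I, [mu]_I, [A]_I) and does
    not hit the corner almost surely.  There are countably many pairs (I, q).

    The Skorokhod problem is solved by monotone Picard iteration.  The only
    input from the M-matrix property is a vector u > 0 with u = 1 + Q u, where
    Q = 1 - R >= 0: the iterates keep the modulus of continuity u_i (osc b). *)

(** * The Skorokhod problem *)

Lemma cvg_bigsum (R : realType) (T : Type) (F : set_system T) {FF : Filter F}
    (I : Type) (r : seq I) (f : I -> T -> R) (l : I -> R) :
  (forall i, f i @ F --> l i) ->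
  (fun x => \sum_(i <- r) f i x) @ F --> \sum_(i <- r) l i.
Proof.
move=> fl; elim: r => [|i r IH].
  rewrite big_nil (_ : (fun _ => _) = cst 0); first exact: cvg_cst.
  by apply/funext => x; rewrite big_nil.
rewrite big_cons (_ : (fun _ => _) = f i \+ (fun x => \sum_(j <- r) f j x)).
  exact: cvgD.
by apply/funext => x; rewrite big_cons.
Qed.

Lemma EVT_max_le (R : realType) (g : R -> R) (a b : R) : a <= b -> continuous g ->
  exists2 s, a <= s <= b & forall r, a <= r <= b -> g r <= g s.
Proof.
move=> ab cg; have [s sab gs] := EVT_max ab (continuous_subspaceT cg).
by exists s => [|r rab]; [move: sab; rewrite in_itv|apply: gs; rewrite in_itv].
Qed.

Definition runmax (R : realType) (g : R -> R) (a b : R) : R :=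
  sup [set g s | s in [set s | a <= s <= b]].

Lemma runmaxP (R : realType) (g : R -> R) (a b : R) : a <= b -> continuous g ->
  exists2 s, a <= s <= b &
    runmax g a b = g s /\ forall r, a <= r <= b -> g r <= g s.
Proof.
move=> ab cg; have [s sab gs] := EVT_max_le ab cg.
exists s => //; split=> //; apply/eqP; rewrite eq_le; apply/andP; split.
  apply: ge_sup; first by exists (g s), s.
  by move=> _ [r rab <-]; exact: gs.
apply: ub_le_sup; last by exists s.
by exists (g s) => _ [r rab <-]; exact: gs.
Qed.

Lemma runmax_ge (R : realType) (g : R -> R) (a b r : R) :
  continuous g -> a <= r <= b -> g r <= runmax g a b.
Proof.
move=> cg rab; have ab : a <= b by case/andP: rab; exact: le_trans.
by have [s _ [-> ]] := runmaxP ab cg; exact.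
Qed.

Lemma runmax_le (R : realType) (g : R -> R) (a b c : R) : a <= b ->
  continuous g -> (forall r, a <= r <= b -> g r <= c) -> runmax g a b <= c.
Proof. by move=> ab cg h; have [s sab [-> _]] := runmaxP ab cg; exact: h. Qed.

(* The regulator of the Skorokhod problem with reflection matrix 1 - Q and
   driving path b is the least fixed point of l_i(t) = sup_(s <= t) max(0, f_i(s))
   with f = Q l - b; the reflected path is then b + (1 - Q) l = l - f. *)
Definition sk_free (R : realType) (m : nat) (Q : 'M[R]_m) (b l : 'I_m -> R -> R)
    (i : 'I_m) (t : R) : R :=
  - b i t + \sum_j Q i j * l j t.

Definition sk_step (R : realType) (m : nat) (Q : 'M[R]_m) (b l : 'I_m -> R -> R)
    (i : 'I_m) (t : R) : R :=
  runmax (fun s => Num.max 0 (sk_free Q b l i s)) 0 (Num.max t 0).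

Definition sk_picard (R : realType) (m : nat) (Q : 'M[R]_m) (b : 'I_m -> R -> R)
    (n : nat) : 'I_m -> R -> R :=
  iter n (sk_step Q b) (fun _ _ => 0).

Definition sk_reg (R : realType) (m : nat) (Q : 'M[R]_m) (b : 'I_m -> R -> R)
    (i : 'I_m) (t : R) : R :=
  sup (range (fun n => sk_picard Q b n i t)).

(* Paths on [0, +oo[ are extended to R by their value at 0, so that their
   continuity is plain continuity on R. *)
Definition stopped0 (R : realType) (f : R -> R) : Prop :=
  forall t, f t = f (Num.max t 0).

(* When 1 + Q u <= u, the Picard map preserves the modulus of continuity
   u_i * (oscillation of b), which is all the compactness needed. *)
Definition sk_modulus (R : realType) (m : nat) (u : 'I_m -> R)
    (b l : 'I_m -> R -> R) : Prop :=
  forall i s t w, 0 <= s <= t ->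
    (forall j r, s <= r <= t -> b j s - b j r <= w) ->
    0 <= l i t - l i s <= u i * w.

Definition sk_admissible (R : realType) (m : nat) (u : 'I_m -> R)
    (b l : 'I_m -> R -> R) : Prop :=
  [/\ forall i, l i 0 = 0, forall i, stopped0 (l i) & sk_modulus u b l].

Lemma continuous_sk_free (R : realType) (m : nat) (Q : 'M[R]_m)
    (b l : 'I_m -> R -> R) i :
  (forall i, continuous (b i)) -> (forall i, continuous (l i)) ->
  continuous (sk_free Q b l i).
Proof.
move=> cb cl t; apply: cvgD; first by apply: cvgN; exact: cb.
by apply: cvg_bigsum => j; apply: cvgM; [exact: cvg_cst|exact: cl].
Qed.

Lemma continuous_max0 (R : realType) (g : R -> R) : continuous g ->
  continuous (fun s => Num.max 0 (g s)).
Proof.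
move=> cg t; apply: (@continuous_max R R (cst 0) g); [exact: cvg_cst|exact: cg].
Qed.

Lemma continuous_stop (R : realType) : continuous (fun t : R => Num.max t 0).
Proof.
move=> t; apply: (@continuous_max R R id (cst 0)); [exact: cvg_id|exact: cvg_cst].
Qed.

(** Near t every b_j moves by at most e / (2 u_i), so it oscillates by at most e / u_i between two
    nearby times, and the modulus bounds the move of l_i by e. Clipping negative times at 0 does not
    increase their distance to t >= 0. *)
Lemma continuous_admissible (R : realType) (m : nat) (u : 'I_m -> R)
    (b l : 'I_m -> R -> R) :
  (forall i, 0 < u i) -> (forall i, continuous (b i)) ->
  sk_admissible u b l -> forall i, continuous (l i).
Proof.
move=> u0 cb [_ ls lm] i.
suff H (t : R) : 0 <= t ->
    (fun s : R => l i (Num.max s 0)) @ t --> l i (Num.max t 0).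
  have H0 : continuous (fun s : R => l i (Num.max (Num.max s 0) 0)).
    move=> t; apply: (@continuous_comp R R R (fun t : R => Num.max t 0)
      (fun s : R => l i (Num.max s 0))); first exact: continuous_stop.
    by apply: H; rewrite le_max lexx orbT.
  rewrite (_ : l i = fun s : R => l i (Num.max (Num.max s 0) 0)) //.
  by apply/funext => s; rewrite -!ls.
move=> t0; apply/cvgrPdist_le => /= e e0.
have e1 : 0 < e / u i / 2 by rewrite !divr_gt0.
have : \forall s \near t, forall j, `|b j t - b j s| <= e / u i / 2.
  apply: (@filter_forall R _ (fun j s => `|b j t - b j s| <= e / u i / 2) (nbhs t)).
  by move=> j; apply: cvgr_dist_le e1; exact: cb.
move=> /nbhs_ballP[d /= d0 hd].
apply/nbhs_ballP; exists d => //= s; rewrite /ball /= => ds.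
rewrite max_l //.
set s' := Num.max s 0.
have s'0 : 0 <= s' by rewrite le_max lexx orbT.
have ds' : `|t - s'| < d.
  rewrite /s'; case: (leP s 0) => s0 //; apply: le_lt_trans ds.
  by rewrite subr0 !ger0_norm; lra.
have osc x y : 0 <= x <= y -> `|t - x| < d -> `|t - y| < d ->
    0 <= l i y - l i x <= e.
  move=> /andP[x0 xy] dx dy.
  have -> : e = u i * (e / u i) by field; rewrite lt0r_neq0.
  apply: lm; first by rewrite x0.
  move=> j r /andP[xr ry].
  have dr : `|t - r| < d.
    by move: dx dy; rewrite !ltr_norml => /andP[? ?] /andP[? ?]; apply/andP; split; lra.
  have hx : `|b j t - b j x| <= _ := hd x dx j.
  have hr : `|b j t - b j r| <= _ := hd r dr j.
  move: hx hr; rewrite !ler_norml => /andP[? ?] /andP[? ?]; lra.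
have dt : `|t - t| < d by rewrite subrr normr0.
case: (leP s' t) => st.
  have /andP[? ?] := osc s' t (introT andP (conj s'0 st)) ds' dt.
  by rewrite ger0_norm.
have /andP[? ?] := osc t s' (introT andP (conj t0 (ltW st))) dt ds'.
by rewrite distrC ger0_norm.
Qed.

(** * Existence by monotone Picard iteration *)

Section SkorokhodReflection.
Context (R : realType) (m : nat) (Q : 'M[R]_m) (u : 'I_m -> R).
Context (b : 'I_m -> R -> R).
Hypothesis Q_ge0 : forall i j, 0 <= Q i j.
Hypothesis u_gt0 : forall i, 0 < u i.
Hypothesis u_dom : forall i, 1 + \sum_j Q i j * u j <= u i.
Hypothesis b_continuous : forall i, continuous (b i).
Hypothesis b_ge0 : forall i, 0 <= b i 0.

(** If b drops by at most w after s, each l_j gains at most u_j w, so f_i = (Q l)_i - b_i gains at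
    most w + (Q u)_i w <= u_i w, and so does the running maximum of max(0, f_i). *)
Lemma sk_step_admissible l :
  sk_admissible u b l -> sk_admissible u b (sk_step Q b l).
Proof.
move=> al; have cl := continuous_admissible u_gt0 b_continuous al.
have cg i := continuous_max0 (@continuous_sk_free _ _ Q b l i b_continuous cl).
have [l0 ls lm] := al; split.
- move=> i; rewrite /sk_step maxxx.
  have [s s0 [-> _]] := runmaxP (lexx 0) (cg i).
  have {s0}-> : s = 0 by apply/eqP; rewrite eq_le andbC.
  (* At time 0 the free term is -b_i(0), which is at most 0 because the path starts in the
     orthant. *)
  rewrite max_l // /sk_free big1 ?addr0 ?oppr_le0 // => j _.
  by rewrite l0 mulr0.
- by move=> i t; rewrite /sk_step; congr (runmax _ _ _); rewrite [RHS]max_l // le_max lexx orbT.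
move=> i s t w /andP[s0 st] bw.
have t0 : 0 <= t by exact: le_trans st.
have w0 : 0 <= w by rewrite -(subrr (b i s)); apply: bw; rewrite lexx.
rewrite /sk_step !max_l // subr_ge0; apply/andP; split.
  apply: runmax_le => // r /andP[r0 rs]; apply: (runmax_ge (cg i)).
  by rewrite r0 (le_trans rs).
rewrite lerBlDr; apply: runmax_le => // r /andP[r0 rt].
have ms0 : 0 <= runmax (fun s => Num.max 0 (sk_free Q b l i s)) 0 s.
  by apply: le_trans (runmax_ge (cg i) (introT andP (conj s0 (lexx s)))); rewrite le_max lexx.
have uw0 : 0 <= u i * w by rewrite mulr_ge0 // ltW.
have [rs|sr] := leP r s.
  by apply: ler_wpDl => //; apply: (runmax_ge (cg i)); rewrite r0.
rewrite ge_max addr_ge0 //=.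
have := runmax_ge (cg i) (introT andP (conj s0 (lexx s))).
rewrite ge_max => /andP[_ fs].
apply: le_trans (_ : u i * w + sk_free Q b l i s <= _); last by rewrite lerD2l.
have uw : w + \sum_j Q i j * u j * w <= u i * w.
  by rewrite -mulr_suml -[X in X + _]mul1r -mulrDl ler_wpM2r.
rewrite /sk_free.
have H1 : \sum_j Q i j * l j r <= \sum_j Q i j * u j * w + \sum_j Q i j * l j s.
  rewrite -big_split /=; apply: ler_sum => j _.
  rewrite -mulrA -mulrDr ler_wpM2l // -lerBlDr.
  suff /lm : forall k x, s <= x <= r -> b k s - b k x <= w.
    by move=> /(_ j); rewrite s0 (ltW sr) => /(_ isT)/andP[].
  by move=> k x /andP[sx xr]; apply: bw; rewrite sx (le_trans xr).
have := bw i r; rewrite (ltW sr) rt => /(_ isT); lra.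
Qed.

Lemma sk_picard_admissible n : sk_admissible u b (sk_picard Q b n).
Proof.
elim: n => [|n IH]; last exact: sk_step_admissible.
split=> // i s t w /andP[s0 st] bw; rewrite subrr lexx /=.
apply: mulr_ge0; first exact: ltW.
rewrite -(subrr (b i s)); apply: bw; rewrite lexx //.
Qed.

Lemma continuous_sk_picard n i : continuous (sk_picard Q b n i).
Proof.
exact: continuous_admissible u_gt0 b_continuous (sk_picard_admissible n) i.
Qed.

Lemma sk_free_le l l' i t : (forall j, l j t <= l' j t) ->
  sk_free Q b l i t <= sk_free Q b l' i t.
Proof.
by move=> ll; rewrite lerD2l; apply: ler_sum => j _; rewrite ler_wpM2l.
Qed.

Lemma sk_picardS_ge n i s t : 0 <= s <= t ->
  Num.max 0 (sk_free Q b (sk_picard Q b n) i s) <= sk_picard Q b n.+1 i t.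
Proof.
move=> /andP[s0 st]; rewrite /= /sk_step.
apply: (@runmax_ge _ (fun s => Num.max 0 (sk_free Q b (sk_picard Q b n) i s))).
  apply: continuous_max0; apply: continuous_sk_free => // j.
  exact: continuous_sk_picard.
by rewrite s0 max_l // (le_trans s0 st).
Qed.

Lemma sk_picardS_le n i t c : 0 <= t ->
  (forall s, 0 <= s <= t ->
     Num.max 0 (sk_free Q b (sk_picard Q b n) i s) <= c) ->
  sk_picard Q b n.+1 i t <= c.
Proof.
move=> t0 h; rewrite /= /sk_step (max_l t0); apply: runmax_le => //.
apply: continuous_max0; apply: continuous_sk_free => // j.
exact: continuous_sk_picard.
Qed.

Lemma sk_picard_leS n i t : sk_picard Q b n i t <= sk_picard Q b n.+1 i t.
Proof.
wlog t0 : t / 0 <= t.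
  move=> h; have [_ s1 _] := sk_picard_admissible n.
  have [_ s2 _] := sk_picard_admissible n.+1.
  by rewrite s1 s2; apply: h; rewrite le_max lexx orbT.
elim: n i t t0 => [|n IH] i t t0.
  by apply: le_trans (sk_picardS_ge 0 i (introT andP (conj t0 (lexx t)))); rewrite le_max lexx.
apply: sk_picardS_le => // s /andP[s0 st].
apply: le_trans (sk_picardS_ge _ _ (introT andP (conj s0 st))).
by apply: le_max2 => //; apply: sk_free_le => j; exact: IH.
Qed.

(** The modulus taken from time 0, with w the sum of the maximal drops of the b_j on [0, t], bounds
    all iterates at once by u_i w. *)
Lemma sk_picard_ub i t : has_ubound (range (fun n => sk_picard Q b n i t)).
Proof.
wlog t0 : t / 0 <= t.
  move=> h; have [|M hM] := h (Num.max t 0); first by rewrite le_max lexx orbT.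
  exists M => _ [n _ <-]; have [_ s1 _] := sk_picard_admissible n.
  by rewrite s1; apply: hM; exists n.
pose w := \sum_j runmax (fun r => b j 0 - b j r) 0 t.
have cbd j : continuous (fun r => b j 0 - b j r).
  by move=> x; apply: cvgB; [exact: cvg_cst|exact: b_continuous].
exists (u i * w) => _ [n _ <-].
have [l0 _ lm] := sk_picard_admissible n.
suff /lm : forall j r, 0 <= r <= t -> b j 0 - b j r <= w.
  by move=> /(_ i); rewrite lexx t0 l0 subr0 => /(_ isT)/andP[].
move=> j r r0t.
rewrite /w (bigD1 j) //=; apply: ler_wpDr; last exact: (runmax_ge (cbd j)).
apply: sumr_ge0 => k _; apply: le_trans (runmax_ge (cbd k) (introT andP (conj (lexx 0) t0))).
by rewrite subrr.
Qed.

Lemma sk_picard_cvg i t : (fun n => sk_picard Q b n i t) @ \oo --> sk_reg Q b i t.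
Proof.
apply: nondecreasing_cvgn; last exact: sk_picard_ub.
by apply/nondecreasing_seqP => n; exact: sk_picard_leS.
Qed.

Lemma sk_picard_le_reg n i t : sk_picard Q b n i t <= sk_reg Q b i t.
Proof. by apply: ub_le_sup; [exact: sk_picard_ub|exists n]. Qed.

Lemma sk_reg_le i t c : (forall n, sk_picard Q b n i t <= c) -> sk_reg Q b i t <= c.
Proof.
by move=> h; apply: ge_sup; [exists (sk_picard Q b 0 i t), 0%N|move=> _ [n _ <-]].
Qed.

(** The modulus does not depend on n, hence passes to the supremum; continuity of the limit then
    needs no uniform convergence. *)
Lemma sk_reg_admissible : sk_admissible u b (sk_reg Q b).
Proof.
split.
- move=> i; apply/eqP; rewrite eq_le; apply/andP; split.
    by apply: sk_reg_le => n; have [-> _ _] := sk_picard_admissible n.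
  exact: (sk_picard_le_reg 0).
- move=> i t; congr (sup _); congr (_ @` _); apply/funext => n.
  by have [_ + _] := sk_picard_admissible n; apply.
move=> i s t w st bw; rewrite subr_ge0 lerBlDr; apply/andP; split.
  apply: sk_reg_le => n; apply: le_trans (sk_picard_le_reg n i t).
  have [_ _ lm] := sk_picard_admissible n.
  by have /andP[] := lm i s t w st bw; rewrite subr_ge0.
apply: sk_reg_le => n.
have [_ _ lm] := sk_picard_admissible n.
have /andP[_] := lm i s t w st bw; rewrite lerBlDr => /le_trans; apply.
by rewrite lerD2l sk_picard_le_reg.
Qed.

Lemma continuous_sk_reg i : continuous (sk_reg Q b i).
Proof. exact: continuous_admissible u_gt0 b_continuous sk_reg_admissible i. Qed.

Lemma sk_reg0 i : sk_reg Q b i 0 = 0.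
Proof. by have [] := sk_reg_admissible. Qed.

Lemma sk_reg_nondecreasing i s t : 0 <= s -> s <= t ->
  sk_reg Q b i s <= sk_reg Q b i t.
Proof.
move=> s0 st; have [_ _ lm] := sk_reg_admissible; rewrite -subr_ge0.
pose w := \sum_j runmax (fun r => b j s - b j r) s t.
have cbd j : continuous (fun r => b j s - b j r).
  by move=> x; apply: cvgB; [exact: cvg_cst|exact: b_continuous].
suff /lm : forall j r, s <= r <= t -> b j s - b j r <= w.
  by move=> /(_ i); rewrite s0 st => /(_ isT)/andP[].
move=> j r rst; rewrite /w (bigD1 j) //=.
apply: ler_wpDr; last exact: (runmax_ge (cbd j)).
apply: sumr_ge0 => k _; apply: le_trans (runmax_ge (cbd k) (introT andP (conj (lexx s) st))).
by rewrite subrr.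
Qed.

Definition sk_path (l : 'I_m -> R -> R) (i : 'I_m) (t : R) : R :=
  l i t - sk_free Q b l i t.

Lemma sk_pathE (C : 'M[R]_m) (l : 'I_m -> R -> R) i t : Q = 1%:M - C ->
  sk_path l i t = b i t + \sum_j C i j * l j t.
Proof.
move=> QE; rewrite /sk_path /sk_free QE.
rewrite (eq_bigr (fun j => (i == j)%:R * l j t - C i j * l j t)); last first.
  by move=> j _; rewrite !mxE mulrBl.
have -> : \sum_j ((i == j)%:R * l j t - C i j * l j t) =
    l i t - \sum_j C i j * l j t.
  rewrite sumrB; congr (_ - _); rewrite (bigD1 i) //= eqxx mul1r big1 ?addr0 // => j ji.
  by rewrite eq_sym (negbTE ji) mul0r.
by ring.
Qed.

(** Pass to the limit in f(l^n) <= l^(n+1) <= l, where l is the limit regulator. *)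
Lemma sk_reg_feasible i t : 0 <= t -> 0 <= sk_path (sk_reg Q b) i t.
Proof.
move=> t0; rewrite subr_ge0.
have cfree : (fun n => sk_free Q b (sk_picard Q b n) i t) @ \oo
    --> sk_free Q b (sk_reg Q b) i t.
  apply: cvgD; first exact: cvg_cst.
  by apply: cvg_bigsum => j; apply: cvgM; [exact: cvg_cst|exact: sk_picard_cvg].
apply: (cvgr_to_le cfree); apply: nearW => n.
apply: le_trans (sk_picard_le_reg n.+1 i t).
apply: le_trans (sk_picardS_ge n i (introT andP (conj t0 (lexx t)))).
by rewrite le_max lexx orbT.
Qed.

(** Let e > 0 be the minimum of the path on [s, t]. As f_i is l_i minus the path, f_i(r) <= l_i(s)
    for r <= s and f_i(r) <= l_i(t) - e for s < r <= t. Hence every iterate at t, and so l_i(t), is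
    at most max(l_i(s), l_i(t) - e); the second value is impossible. *)
Lemma sk_reg_flat i s t : 0 <= s -> s <= t ->
  (forall r, s <= r <= t -> 0 < sk_path (sk_reg Q b) i r) ->
  sk_reg Q b i t = sk_reg Q b i s.
Proof.
move=> s0 st Zpos; apply/eqP; rewrite eq_le (sk_reg_nondecreasing i s0 st) andbT.
have t0 : 0 <= t by exact: le_trans st.
have cZ : continuous (fun r => - sk_path (sk_reg Q b) i r).
  move=> x; apply: cvgN; apply: cvgB; first exact: continuous_sk_reg.
  by apply: continuous_sk_free => // j; exact: continuous_sk_reg.
have [r0 r0st hr] := EVT_max_le st cZ.
have e0 := Zpos r0 r0st; set e := sk_path _ _ r0 in e0 hr.
suff : sk_reg Q b i t <= Num.max (sk_reg Q b i s) (sk_reg Q b i t - e).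
  by rewrite le_max => /orP[//|]; lra.
apply: sk_reg_le => n; apply: le_trans (sk_picard_leS n i t) _.
apply: sk_picardS_le => // r /andP[r_ge0 rt].
rewrite ge_max; apply/andP; split.
  by rewrite le_max -[X in X <= _](sk_reg0 i) sk_reg_nondecreasing.
apply: le_trans (_ : sk_free Q b (sk_reg Q b) i r <= _).
  by apply: sk_free_le => j; exact: sk_picard_le_reg.
rewrite le_max; have [rs|sr] := leP r s.
  apply/orP; left; apply: le_trans (_ : sk_reg Q b i r <= _).
    by have := sk_reg_feasible i r_ge0; rewrite subr_ge0.
  exact: sk_reg_nondecreasing.
apply/orP; right.
have := hr r; rewrite (ltW sr) rt => /(_ isT); rewrite lerN2 /sk_path.
have := sk_reg_nondecreasing i r_ge0 rt; lra.
Qed.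

End SkorokhodReflection.

(** * Uniqueness in the Skorokhod problem, and the M-matrix weight *)

Lemma continuous_delta (R : realType) (f : R -> R) (t e : R) :
  continuous f -> 0 < e ->
  exists2 d : R, 0 < d & forall s, `|t - s| < d -> `|f t - f s| < e.
Proof.
move=> cf e0; have /cvgrPdist_lt/(_ e e0)/nbhs_ballP[d d0 hd] := cf t.
by exists d.
Qed.

(** Integral-free form of the complementarity condition int y dl = 0; [stieltjes_int0_flat] and
    [flat_stieltjes_int0] connect the two on [0, +oo[. *)
Definition flat_off_zeros (R : realType) (y l : R -> R) (T : R) : Prop :=
  forall a c, 0 <= a -> a <= c -> c <= T ->
    (forall r, a <= r <= c -> 0 < y r) -> l c = l a.

(** Take for s the supremum of the zeros of y in [0, t], a zero by continuity. Then l is constant on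
    [s', t] whenever s < s' <= t, and continuity of l reaches s. If there is no zero, l is constant
    on [0, t]. *)
Lemma flat_last_zero (R : realType) (y l : R -> R) (t : R) :
  0 <= t -> continuous y -> continuous l ->
  (forall s, 0 <= s <= t -> 0 <= y s) -> flat_off_zeros y l t ->
  l t = l 0 \/ exists2 s, 0 <= s <= t & y s = 0 /\ l t = l s.
Proof.
move=> t0 cy cl y0 fl.
pose S := [set s | 0 <= s <= t /\ y s = 0].
have [S0|/forallNP S0] := pselect (S !=set0); last first.
  left; apply: fl => // r rt; rewrite lt0r y0 // andbT.
  by apply/eqP => yr; apply: (S0 r).
have supS : has_sup S by split=> //; exists t => s [/andP[]].
have ubS s : S s -> s <= sup S by move=> Ss; apply: ub_le_sup => //; case: supS.
have St : sup S <= t by apply: ge_sup => // s [/andP[]].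
have S_ge0 : 0 <= sup S by have [s Ss] := S0; apply: le_trans (ubS s Ss); case: Ss => /andP[].
right; exists (sup S); first by rewrite S_ge0.
split.
  apply/eqP; rewrite eq_le y0 ?S_ge0 // andbT leNgt; apply/negP => ypos.
  have [d d0 hd] := continuous_delta (sup S) cy ypos.
  have [s Ss sd] := sup_adherent d0 supS.
  have := hd s _; rewrite (ger0_norm (_ : 0 <= sup S - s)) ?subr_ge0 ?ubS // => /(_ ltac:(lra)).
  by have [_ ->] := Ss; rewrite subr0 ger0_norm ?ltxx // ltW.
apply/eqP; rewrite -subr_eq0 -normr_eq0; apply/negPn/negP => ne.
have e0 : 0 < `|l t - l (sup S)| by rewrite lt0r ne /=.
have [d d0 hd] := continuous_delta (sup S) cl e0.
have tS : sup S < t.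
  by rewrite lt_neqAle St andbT; apply: contraNneq ne => ->; rewrite subrr normr0.
(* This point lies after the last zero, so l s = l t, yet within d of it, so l s is strictly closer
   to l (sup S) than l t is. *)
pose s := Num.min (sup S + d / 2) t.
have Ss : sup S < s by rewrite lt_min tS andbT; lra.
have sd : s <= sup S + d / 2 by rewrite ge_min lexx.
have st : s <= t by rewrite ge_min lexx orbT.
have := hd s; rewrite distrC (ger0_norm (_ : 0 <= s - sup S)) ?subr_ge0 ?(ltW Ss) // => /(_ ltac:(lra)).
rewrite distrC (fl s t) ?ltxx // ?(le_trans S_ge0 (ltW Ss)) //.
move=> r /andP[sr rt]; rewrite lt0r y0 ?rt ?andbT.
  apply/eqP => yr; have := ubS r; rewrite leNgt (lt_le_trans Ss sr) /=.
  by move=> /(_ _)/notF; apply; split=> //; rewrite rt (le_trans (le_trans S_ge0 (ltW Ss))).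
by rewrite (le_trans (le_trans S_ge0 (ltW Ss))).
Qed.

Section SkorokhodMinimality.
Context (R : realType) (m : nat) (Q : 'M[R]_m) (u : 'I_m -> R).
Context (b : 'I_m -> R -> R) (T : R).
Hypothesis Q_ge0 : forall i j, 0 <= Q i j.
Hypothesis u_gt0 : forall i, 0 < u i.
Hypothesis u_dom : forall i, 1 + \sum_j Q i j * u j <= u i.
Hypothesis b_continuous : forall i, continuous (b i).

(* At the last zero s of the i-th coordinate before the time where
   (l_i - l'_i) / u_i is maximal, equal to D > 0, one gets
   u_i D <= (Q u)_i D, contradicting Q u < u. *)
Lemma sk_minimal (l l' : 'I_m -> R -> R) :
  (forall i, continuous (l i)) -> (forall i, continuous (l' i)) ->
  (forall i, l i 0 = 0) -> (forall i, 0 <= l' i 0) ->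
  (forall i s t, 0 <= s -> s <= t -> t <= T -> l' i s <= l' i t) ->
  (forall i t, 0 <= t <= T -> 0 <= sk_path Q b l i t) ->
  (forall i t, 0 <= t <= T -> 0 <= sk_path Q b l' i t) ->
  (forall i, flat_off_zeros (sk_path Q b l i) (l i) T) ->
  forall i t, 0 <= t <= T -> l i t <= l' i t.
Proof.
move=> cl cl' l0 l'0 ndl' Z0 Z'0 fl k t0 t0T.
have T0 : 0 <= T by case/andP: t0T; exact: le_trans.
pose phi i t := (l i t - l' i t) / u i.
have cphi i : continuous (phi i).
  by move=> t; apply: cvgMl; apply: cvgB; [exact: cl|exact: cl'].
have /choice[tm htm] : forall i, exists s, 0 <= s <= T /\
    forall r, 0 <= r <= T -> phi i r <= phi i s.
  by move=> i; have [s sT hs] := EVT_max_le T0 (cphi i); exists s.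
have [i _ imax] := @arg_maxP _ _ _ k predT (fun i => phi i (tm i)) isT.
set D := phi i (tm i).
have Dmax j r : 0 <= r <= T -> phi j r <= D.
  by move=> rT; apply: le_trans (imax j isT); apply: (htm j).2.
rewrite leNgt; apply/negP => lt_l.
have D0 : 0 < D.
  by apply: lt_le_trans (Dmax k t0 t0T); rewrite divr_gt0 // subr_gt0.
have [/andP[ti0 tiT] _] := htm i; set t := tm i in ti0 tiT.
have Dt : l i t - l' i t = u i * D by rewrite /D /phi -/t mulrC divfK // lt0r_neq0.
have uD : 0 < u i * D by rewrite mulr_gt0.
have cZ : continuous (sk_path Q b l i).
  by move=> x; apply: cvgB; [exact: cl|exact: continuous_sk_free].
case: (flat_last_zero ti0 cZ (cl i)).
- by move=> s /andP[s0 st]; apply: Z0; rewrite s0 (le_trans st).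
- by move=> a c a0 ac ct; apply: fl => //; exact: le_trans tiT.
- rewrite l0 => lt0; have := ndl' i 0 t (lexx 0) ti0 tiT; have := l'0 i; lra.
move=> [s /andP[s0 st] [Zs lts]].
have sT : s <= T by exact: le_trans tiT.
have := Z'0 i s; rewrite s0 sT => /(_ isT); move: Zs.
have := ndl' i s t s0 st tiT.
rewrite /sk_path /sk_free => H1 H2 H3.
(* The chain is u_i D <= (l_i - l'_i)(s) <= (Q (l - l')(s))_i <= (Q u)_i D <= (u_i - 1) D; its
   second inequality compares the vanishing path of l at s with the nonnegative path of l'. *)
have : \sum_j Q i j * l j s - \sum_j Q i j * l' j s <= (\sum_j Q i j * u j) * D.
  rewrite -sumrB mulr_suml; apply: ler_sum => j _.
  rewrite -mulrBr -mulrA ler_wpM2l // mulrC -ler_pdivrMr //.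
  by apply: Dmax; rewrite s0.
have := u_dom i; rewrite -(ler_pM2r D0) mulrDl; lra.
Qed.
End SkorokhodMinimality.

(** * A positive weight for an M-matrix *)

Lemma family_min (R : realType) (I : finType) (f : I -> R -> R) (i0 : I) :
  (forall i, continuous (f i)) ->
  exists2 g : R -> R, continuous g &
    forall x, (exists i, g x = f i x) /\ forall i, g x <= f i x.
Proof.
move=> cf; suff H (r : seq I) : exists2 g : R -> R, continuous g &
    forall x, (exists i, g x = f i x) /\ forall i, i \in i0 :: r -> g x <= f i x.
  have [g cg hg] := H (enum I); exists g => // x; have [ex le] := hg x.
  by split=> // i; apply: le; rewrite inE mem_enum orbT.
elim: r => [|i r [g cg hg]].
  exists (f i0) => // x; split; first by exists i0.
  by move=> i; rewrite inE => /eqP ->.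
exists (g \min f i).
  by move=> x; apply: (@continuous_min R R g (f i)); [exact: cg|exact: cf].
move=> x; have [[j gj] hx] := hg x; split.
  by rewrite /= minEle; case: ifP => _; [exists j|exists i].
move=> k; rewrite !inE orbCA => /orP[/eqP ->|kr] /=.
  by rewrite ge_min lexx orbT.
by rewrite ge_min hx // inE.
Qed.

(** A real root x >= 1 would be a complex eigenvalue of modulus at least 1. *)
Lemma spectral_radius_unit (R : realType) (d : nat) (Q : 'M[R]_d) (x : R) :
  spectral_radius_lt1 Q -> 1 <= x -> (char_poly Q).[x] != 0.
Proof.
move=> rQ x1; apply/negP => /eqP/rootP Qx.
have := rQ (real_complex R x).
rewrite -(map_char_poly (real_complex R)) fmorph_root => /(_ Qx).
rewrite normc_def /= expr0n /= addr0 sqrtr_sqr.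
rewrite (ltcR _ 1) => x_lt1; have := le_lt_trans (ler_norm x) x_lt1.
by rewrite ltNge x1.
Qed.

(* The vector (x - Q)^-1 1, as a rational function of x. *)
Definition resolvent1 (R : realType) (d : nat) (Q : 'M[R]_d) (i : 'I_d) (x : R) : R :=
  (\sum_j (\adj (char_poly_mx Q)) i j).[x] / (char_poly Q).[x].

(** Sum row i of (x - Q) adj(x - Q) = chi(x) 1 over the columns and divide by chi(x), where chi is
    the characteristic polynomial. *)
Lemma resolvent1E (R : realType) (d : nat) (Q : 'M[R]_d) (i : 'I_d) (x : R) :
  (char_poly Q).[x] != 0 ->
  x * resolvent1 Q i x = 1 + \sum_k Q i k * resolvent1 Q k x.
Proof.
move=> nz; pose N := \adj (char_poly_mx Q).
have E : \sum_j (char_poly_mx Q *m N) i j = char_poly Q.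
  rewrite mul_mx_adj (bigD1 i) //= big1 ?addr0 => [|j ji].
    by rewrite mxE eqxx mulr1n.
  by rewrite mxE eq_sym (negbTE ji) mulr0n.
have {}E : (char_poly Q).[x] = x * (\sum_j N i j).[x] - \sum_k Q i k * (\sum_j N k j).[x].
  rewrite -{}E; under eq_bigr do rewrite mxE.
  rewrite exchange_big /= (eq_bigr (fun k => char_poly_mx Q i k * \sum_j N k j)); last first.
    by move=> k _; rewrite mulr_sumr.
  rewrite (eq_bigr (fun k => ('X *+ (i == k)) * (\sum_j N k j) - (Q i k)%:P * (\sum_j N k j))); last first.
    by move=> k _; rewrite !mxE mulrBl.
  rewrite sumrB hornerD hornerN; congr (_ - _).
    rewrite (bigD1 i) //= eqxx mulr1n [X in _ + X]big1 => [|k ki].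
      by rewrite addr0 hornerM hornerX.
    by rewrite eq_sym (negbTE ki) mulr0n mul0r.
  by rewrite horner_sum; apply: eq_bigr => k _; rewrite hornerM hornerC.
have -> : \sum_k Q i k * resolvent1 Q k x =
    (\sum_k Q i k * (\sum_j N k j).[x]) / (char_poly Q).[x].
  by rewrite mulr_suml; apply: eq_bigr => k _; rewrite mulrA.
rewrite /resolvent1 -/N mulrA; apply: (mulIf nz).
by rewrite mulrDl !mulfVK // mul1r E; lra.
Qed.

(* By the intermediate value theorem: if min_i ((x - Q)^-1 1)_i, which is
   positive for large x, were not positive at x = 1, it would vanish at some
   x >= 1; but a nonnegative solution of x v = 1 + Q v satisfies x v >= 1. *)
Lemma reflection_M_matrix_weight (R : realType) (d : nat) (Rm : 'M[R]_d) :
  reflection_M_matrix Rm ->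
  exists u : 'I_d -> R, (forall i, 0 < u i) /\
    forall i, 1 + \sum_j (1%:M - Rm) i j * u j = u i.
Proof.
move=> [diag off rQ]; set Q := 1%:M - Rm.
have Q0 i j : 0 <= Q i j.
  rewrite !mxE; have [->|ij] := eqVneq i j; first by rewrite diag subrr.
  by rewrite mulr0n sub0r oppr_ge0 off.
have [/card0_eq I0|/card_gt0P[i0 _]] := posnP #|'I_d|.
  by exists (fun _ => 1); split=> i; have := I0 i.
(* Clamping at 1 keeps x where the denominator does not vanish, so that [f i] is continuous on all
   of R. *)
pose f i x := resolvent1 Q i (Num.max x 1).
have cmax : continuous (fun x : R => Num.max x 1).
  by move=> t; apply: (@continuous_max R R id (cst 1)); [exact: cvg_id|exact: cvg_cst].
have chipos x : (char_poly Q).[Num.max x 1] != 0.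
  by apply: spectral_radius_unit => //; rewrite le_max lexx orbT.
have cf i : continuous (f i).
  move=> x; apply: cvgM; last apply: cvgV => //.
    exact: (@continuous_comp R R R (fun x : R => Num.max x 1) (horner _) x (cmax x) (@continuous_horner _ _ _)).
  exact: (@continuous_comp R R R (fun x : R => Num.max x 1) (horner _) x (cmax x) (@continuous_horner _ _ _)).
have fE i x : Num.max x 1 * f i x = 1 + \sum_k Q i k * f k x.
  exact: resolvent1E.
have [g cg hg] := family_min i0 cf.
(* M is at least 1 + (row sum) for every row. A negative minimum g(M), attained at i, would give 1 +
   (row sum) g(M) <= M g(M) <= (1 + row sum) g(M), that is g(M) >= 1; for g(M) = 0 the equation
   reads 0 = 1 + (a nonnegative sum). *)
pose M := 1 + \sum_i \sum_j Q i j.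
have M1 : 1 <= M by rewrite lerDl; do 2 (apply: sumr_ge0 => ? _).
have gM : 0 < g M.
  have [[i gi] gle] := hg M; rewrite ltNge; apply/negP => g0.
  have := fE i M; rewrite max_l // -gi.
  have : (\sum_k Q i k) * g M <= \sum_k Q i k * f k M.
    by rewrite mulr_suml; apply: ler_sum => k _; rewrite ler_wpM2l.
  have : 1 + \sum_k Q i k <= M.
    rewrite lerD2l [X in _ <= X](bigD1 i) //= lerDl; apply: sumr_ge0 => j _.
    exact: sumr_ge0.
  rewrite -(ler_nM2r (_ : g M < 0)).
    rewrite mulrDl; lra.
  rewrite lt_neqAle g0 andbT; apply/eqP => gM0.
  have := fE i M; rewrite -gi gM0 mulr0 => /esym/eqP; apply/negP.
  rewrite gt_eqF // ltr_wpDr // sumr_ge0 // => k _.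
  by apply: mulr_ge0 => //; rewrite -gM0.
have g1 : 0 < g 1.
  rewrite ltNge; apply/negP => g0.
  have [|c] := IVT M1 (continuous_subspaceT cg) (_ : _ <= 0 <= _).
    by rewrite ge_min g0 le_max (ltW gM) orbT.
  rewrite in_itv /= => /andP[c1 _] gc0.
  have [[i gi] gle] := hg c; have := fE i c; rewrite -gi gc0 mulr0.
  move=> /esym/eqP; apply/negP.
  rewrite gt_eqF // ltr_wpDr // sumr_ge0 // => k _.
  by apply: mulr_ge0 => //; rewrite -gc0.
exists (f ^~ 1); split=> i; first by apply: lt_le_trans g1 _; have [] := hg 1.
by have := fE i 1; rewrite maxxx mul1r.
Qed.

(** * Complementarity as a Stieltjes integral *)

Lemma within_ge0_continuous (R : realType) (f : R -> R) :
  {within [set t : R | 0 <= t], continuous f} <->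
  continuous (fun t : R => f (Num.max t 0)).
Proof.
split=> [/subspace_continuousP cf t|cf].
  have t0 : 0 <= Num.max t 0 by rewrite le_max lexx orbT.
  apply: cvg_comp (cf _ t0) => A nA.
  have : nbhs t (fun s : R => 0 <= Num.max s 0 -> A (Num.max s 0)).
    exact: (@continuous_stop R t _ nA).
  by apply: (@filterS R (nbhs t)) => s; apply; rewrite le_max lexx orbT.
apply/(@subspace_eq_continuous _ [set t : R | 0 <= t] _ (fun t : R => f (Num.max t 0))).
  by move=> t; rewrite inE /= => t0; rewrite max_l.
exact: continuous_subspaceT.
Qed.

Lemma continuous_shift (R : realType) (f : R -> R) (q : R) : 0 <= q ->
  {within [set t : R | 0 <= t], continuous f} ->
  continuous (fun t : R => f (q + Num.max t 0)).
Proof.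
move=> q0 /within_ge0_continuous cf.
rewrite (_ : (fun t : R => _) =
    (fun t : R => f (Num.max t 0)) \o (fun t : R => q + Num.max t 0)).
  move=> t; apply: continuous_comp; last exact: cf.
  by apply: cvgD; [exact: cvg_cst|exact: continuous_stop].
apply/funext => t /=; congr (f _).
by rewrite [RHS]max_l // addr_ge0 // le_max lexx orbT.
Qed.

Lemma lebesgue_stieltjes_ocitv (R : realType) (f : cumulative R R) (a b : R) :
  a <= b -> lebesgue_stieltjes_measure f `]a, b]%classic = (f b - f a)%:E.
Proof.
move=> ab; rewrite /lebesgue_stieltjes_measure /measure_extension /=.
by rewrite measurable_mu_extE /= ?wlength_itv_bnd //; exact: is_ocitv.
Qed.

Section StieltjesFlat.
Context (R : realType) (Y L : R -> R).
Hypothesis Y_continuous : continuous (fun t : R => Y (Num.max t 0)).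
Hypothesis Y_ge0 : forall t, 0 <= t -> 0 <= Y t.

Let D : set R := [set t : R | 0 <= t].

Let measurable_D : measurable D.
Proof.
rewrite (_ : D = `[0, +oo[%classic) //; apply/seteqP; split=> t;
  by rewrite /D /= in_itv /= andbT.
Qed.

Let measurable_Y : measurable_fun D (EFin \o Y).
Proof.
apply/measurable_EFinP.
apply: (@eq_measurable_fun _ _ _ _ _ (fun t : R => Y (Num.max t 0))).
  by move=> t; rewrite inE /D /= => t0; rewrite max_l.
apply: measurable_funS (continuous_measurable_fun Y_continuous) => //; exact: measurableT.
Qed.

(** If Y(r) > 0 is the minimum of Y on [a, c], then Y(r) (L(c) - L(a)) is at most the integral of Y
    dL over ]a, c], itself at most the total integral 0. *)
Lemma stieltjes_int0_flat a c : stieltjes_int0 Y L -> 0 <= a -> a <= c ->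
  (forall r, a <= r <= c -> 0 < Y r) -> L c = L a.
Proof.
move=> [f [fE int0]] a0 ac Ypos.
have c0 : 0 <= c by exact: le_trans ac.
have cN : continuous (fun t : R => - Y (Num.max t 0)).
  by move=> t; apply: cvgN; exact: Y_continuous.
have [r /andP[ar rc] hr] := EVT_max_le ac cN.
have r0 : 0 <= r by exact: le_trans ar.
have Yr : 0 < Y r by apply: Ypos; rewrite ar.
have : ((Y r)%:E * lebesgue_stieltjes_measure f `]a, c]%classic <= 0)%E.
  rewrite -int0 -integral_cst //.
  apply: le_trans (_ : \int[lebesgue_stieltjes_measure f]_(t in `]a, c]%classic) (Y t)%:E <= _)%E.
    apply: ge0_le_integral => //.
    - by move=> t _; rewrite lee_fin ltW.
    - apply: measurable_funS measurable_Y => // t /=.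
      by rewrite in_itv /= => /andP[/ltW at_ _]; exact: le_trans at_.
    - move=> t /=; rewrite in_itv /= => /andP[/ltW at_ tc].
      have := hr t; rewrite at_ tc => /(_ isT).
      by rewrite !max_l ?(le_trans a0) // lee_fin lerN2.
  apply: ge0_subset_integral => //. 
  by move=> t /=; rewrite in_itv /= => /andP[/ltW at_ _]; exact: le_trans at_.
rewrite lebesgue_stieltjes_ocitv // -EFinM lee_fin pmulr_rle0 //.
rewrite !fE !max_l // subr_le0 => Lca; apply/eqP; rewrite eq_le Lca /=.
by have := cumulative_is_nondecreasing f _ _ ac; rewrite !fE !max_l.
Qed.

Hypothesis L_continuous : continuous (fun t : R => L (Num.max t 0)).
Hypothesis L_nondecreasing : forall s t, 0 <= s -> s <= t -> L s <= L t.

(** The set where Y > 0 is covered by the countably many intervals with rational endpoints on which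
    Y is positive, and flatness makes each of them null for dL. *)
Lemma flat_stieltjes_int0 :
  (forall a c, 0 <= a -> a <= c -> (forall r, a <= r <= c -> 0 < Y r) ->
     L c = L a) -> stieltjes_int0 Y L.
Proof.
move=> flat; pose g (t : R) := L (Num.max t 0).
have g_nd : nondecreasing g.
  move=> s t st; apply: L_nondecreasing; first by rewrite le_max lexx orbT.
  by rewrite le_max2.
have g_rc : right_continuous g := @right_continuousW R _ R g L_continuous.
pose f : cumulative R R := HB.pack g (isCumulative.Build R _ R g g_nd g_rc).
exists f; split => //.
(* An interval around t = 0 starts at a negative rational, so Y is read through its extension by
   Y(0). *)
pose N (p : rat * rat) : set R :=
  if pselect (ratr p.1 <= ratr p.2 :> R /\
    forall r : R, ratr p.1 <= r <= ratr p.2 -> 0 < Y (Num.max r 0))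
  then `]ratr p.1, ratr p.2]%classic else set0.
have mN p : (R.-ocitv.-measurable).-sigma.-measurable (N p).
  by rewrite /N; case: pselect => ?; [exact: (@measurable_itv R)|exact: measurable0].
have N0 p : lebesgue_stieltjes_measure f (N p) = 0%E.
  rewrite /N; case: pselect => [[/= ab Ypos]|?]; last by rewrite measure0.
  rewrite lebesgue_stieltjes_ocitv //=.
  rewrite /g (flat (Num.max (ratr p.1) 0) (Num.max (ratr p.2) 0)) ?subrr //.
  - by rewrite le_max lexx orbT.
  - by rewrite le_max2.
  move=> r /andP[ar rb].
  have r0 : 0 <= r by apply: le_trans ar; rewrite le_max lexx orbT.
  have ar' : ratr p.1 <= r by apply: le_trans ar; rewrite le_max lexx.
  move: rb; rewrite le_max => /orP[rb|r_le0].
    by have := Ypos r; rewrite ar' rb max_l //; exact.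
  have re0 : r = 0 by apply/eqP; rewrite eq_le r_le0.
  have [b0|b0] := leP 0 (ratr p.2 : R).
    by have := Ypos r; rewrite ar' re0 b0 maxxx; apply.
  (* Both endpoints are negative and clamp to 0; the extension of Y takes the value Y(0) at
     [ratr p.2], which gives Y(0) > 0. *)
  by have := Ypos (ratr p.2); rewrite ab lexx (max_r (ltW b0)) re0; apply.
pose NN := \bigcup_k N (odflt (0, 0) (unpickle k)).
have NNE : [set t | 0 <= t /\ Y t != 0] `<=` NN.
  move=> t [t0 Yt]; have Yt0 : 0 < Y (Num.max t 0).
    by rewrite max_l // lt0r Yt Y_ge0.
  have [e e0 he] := continuous_delta t Y_continuous Yt0.
  have Ypos s : `|t - s| < e -> 0 < Y (Num.max s 0).
    by move=> /he; rewrite ltr_norml => /andP[_]; lra.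
  have [|p1] := @rat_in_itvoo R (t - e) t; first by lra.
  rewrite in_itv /= => /andP[p1a p1b].
  have [|p2] := @rat_in_itvoo R t (t + e); first by lra.
  rewrite in_itv /= => /andP[p2a p2b].
  exists (pickle (p1, p2)) => //; rewrite pickleK /= /N.
  case: pselect => [?|]; first by rewrite /= in_itv /= p1b ltW.
  case; split; first by rewrite ltW // (lt_trans p1b).
  by move=> r /= /andP[r1 r2]; apply: Ypos; rewrite ltr_norml; apply/andP; split; lra.
have mNN : (R.-ocitv.-measurable).-sigma.-measurable NN.
  by apply: bigcup_measurable => k _; exact: mN.
have NN0 : lebesgue_stieltjes_measure f NN = 0%E.
  apply: (iffLR (negligibleP _ mNN)); apply: negligible_bigcup => k.
  exact: (iffRL (negligibleP _ (mN _)) (N0 _)).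
rewrite (ge0_negligible_integral mNN) //.
apply: integral0_eq => t [t0 tNN]; congr (_%:E); apply/eqP/negPn/negP => Yt.
by apply: tNN; apply: NNE.
Qed.
End StieltjesFlat.

(** * Measurability *)

(** By continuity the maximum exceeds x exactly when g does at some rational time clamped to [a, b];
    the clamping also covers a = b. *)
Lemma measurable_runmax (R : realType) (d : measure_display) (T : measurableType d)
    (g : R -> T -> R) (a b : R) : a <= b ->
  (forall w, continuous (g ^~ w)) ->
  (forall s, a <= s <= b -> measurable_fun setT (g s)) ->
  measurable_fun setT (fun w => runmax (g ^~ w) a b).
Proof.
move=> ab cg mg _.
pose cl (x : R) := Num.min (Num.max x a) b.
have ccl : continuous cl.
  move=> x; apply: (@continuous_min R R (fun x => Num.max x a) (cst b)).
    by apply: (@continuous_max R R id (cst a)); [exact: cvg_id|exact: cvg_cst].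
  exact: cvg_cst.
have clE x : a <= cl x <= b.
  by rewrite /cl le_min ab le_max lexx orbT ge_min lexx orbT.
apply: (measurability _ (RGenOInfty.measurableE R)) => //.
move=> _ [_ [x ->] <-]; rewrite setTI.
rewrite (_ : _ @^-1` _ = \bigcup_q ((g (cl (ratr q))) @^-1` `]x, +oo[%classic)).
  apply: bigcupT_measurable_rat => q; rewrite -[X in measurable X]setTI.
  by apply: mg => //; exact: measurable_itv.
apply/seteqP; split=> w /=; rewrite in_itv /= andbT.
  have [s sab [-> _]] := runmaxP ab (cg w) => xg.
  have cgcl : continuous (fun r => g (cl r) w).
    by move=> r; apply: (@continuous_comp R R R cl (g ^~ w)); [exact: ccl|exact: cg].
  have cls : cl s = s by case/andP: sab => as_ sb; rewrite /cl max_l // min_l.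
  have e0 : 0 < g s w - x by rewrite subr_gt0.
  have [e e1 he] := continuous_delta s cgcl e0.
  have [|q] := @rat_in_itvoo R s (s + e); first by rewrite ltrDl.
  rewrite in_itv /= => /andP[q1 q2]; exists q => //=.
  rewrite in_itv /= andbT; have := he (ratr q).
  rewrite cls !ltr_norml => h.
  have /andP[_] : - (g s w - x) < g s w - g (cl (ratr q)) w < g s w - x.
    by apply: h; apply/andP; split; lra.
  by lra.
move=> [q _] /=; rewrite in_itv /= andbT => /lt_le_trans; apply.
by apply: (runmax_ge (cg w)); exact: clE.
Qed.

Lemma measurable_sk_free (R : realType) (m : nat) (Q : 'M[R]_m) (d : measure_display)
    (T : measurableType d) (b l : 'I_m -> R -> T -> R) i s :
  (forall j, measurable_fun setT (b j s)) ->
  (forall j, measurable_fun setT (l j s)) ->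
  measurable_fun setT
    (fun w => sk_free Q (fun j r => b j r w) (fun j r => l j r w) i s).
Proof.
move=> mb ml; apply: measurable_funD; first exact: measurableT_comp.
by apply: measurable_sum => j; apply: measurable_funM => //; exact: measurable_cst.
Qed.

Section MeasurableReflection.
Context (R : realType) (m : nat) (Q : 'M[R]_m) (u : 'I_m -> R).
Context (d : measure_display) (T : measurableType d) (b : 'I_m -> R -> T -> R).
Hypothesis Q_ge0 : forall i j, 0 <= Q i j.
Hypothesis u_gt0 : forall i, 0 < u i.
Hypothesis u_dom : forall i, 1 + \sum_j Q i j * u j <= u i.
Hypothesis b_continuous : forall w i, continuous (fun t => b i t w).
Hypothesis b_ge0 : forall w i, 0 <= b i 0 w.

Let reg i t w := sk_reg Q (fun j r => b j r w) i t.

(** Only the driving path up to t enters, and the sigma-algebra on [T] is arbitrary: F(q + t) yields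
    adaptedness, a product sigma-algebra yields joint measurability in the start and the
    increments. *)
Lemma measurable_sk_reg t i :
  (forall i s, 0 <= s <= t -> measurable_fun setT (b i s)) ->
  0 <= t -> measurable_fun setT (reg i t).
Proof.
move=> mb t0.
suff mp n s : 0 <= s <= t -> forall i,
    measurable_fun setT (fun w => sk_picard Q (fun j r => b j r w) n i s).
  apply: measurable_fun_cvg (fun n => mp n t _ i) _; first by rewrite t0 lexx.
  by move=> w _; apply: (sk_picard_cvg Q_ge0 u_gt0 u_dom).
elim: n s => [|n IH] s st k; first exact: measurable_cst.
have /andP[s0 _] := st.
apply: (@measurable_runmax _ _ _ (fun r w => Num.max 0
  (sk_free Q (fun j r => b j r w) (sk_picard Q (fun j r => b j r w) n) k r))).
- by rewrite le_max lexx orbT.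
- move=> w; apply: continuous_max0; apply: continuous_sk_free => // j.
  exact: (continuous_sk_picard Q_ge0 u_gt0 u_dom).
move=> r; rewrite max_l // => /andP[r0 rs].
have rt : 0 <= r <= t by rewrite r0; case/andP: st => _; exact: le_trans.
apply: measurable_maxr; first exact: measurable_cst.
by apply: (@measurable_sk_free _ _ Q _ _ b (fun j r w => sk_picard Q (fun j r => b j r w) n j r)) => j; [exact: mb|exact: IH].
Qed.

Lemma measurable_sk_path t i :
  (forall i s, 0 <= s <= t -> measurable_fun setT (b i s)) ->
  0 <= t -> measurable_fun setT
    (fun w => sk_path Q (fun j r => b j r w) (sk_reg Q (fun j r => b j r w)) i t).
Proof.
move=> mb t0; apply: measurable_funB; first exact: measurable_sk_reg.
apply: (@measurable_sk_free _ _ Q _ _ b reg) => j; last exact: measurable_sk_reg.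
by apply: mb; rewrite t0 lexx.
Qed.

Lemma continuous_sk_path w i : continuous
  (sk_path Q (fun j r => b j r w) (sk_reg Q (fun j r => b j r w)) i).
Proof.
move=> x; apply: cvgB; first exact: (continuous_sk_reg Q_ge0 u_gt0 u_dom).
apply: continuous_sk_free => // j; exact: (continuous_sk_reg Q_ge0 u_gt0 u_dom).
Qed.

End MeasurableReflection.

(** Nonnegative coordinates vanish together exactly when minus their sum is >= 0, so hitting during
    [1/(n+1), n+1] is a condition on a running maximum. These windows exhaust ]0, +oo[ and avoid
    time 0. *)
Lemma measurable_hits0 (R : realType) (m : nat) (d : measure_display)
    (T : measurableType d) (Z : 'I_m -> R -> T -> R) :
  (forall w i, continuous (fun t => Z i t w)) ->
  (forall w i t, 0 <= t -> 0 <= Z i t w) ->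
  (forall i t, 0 <= t -> measurable_fun setT (Z i t)) ->
  measurable [set w | exists2 t, 0 < t & forall i, Z i t w = 0].
Proof.
move=> cZ Z0 mZ.
pose a n : R := n.+1%:R^-1; pose c n : R := n.+1%:R.
have a0 n : 0 < a n by rewrite invr_gt0 ltr0n.
have ac n : a n <= c n.
  by apply: (@le_trans _ _ 1); rewrite ?invf_le1 ?ltr0n ?ler1n.
pose S t w := - \sum_i Z i t w.
have cS w : continuous (S ^~ w).
  by move=> t; apply: cvgN; apply: cvg_bigsum => i; exact: cZ.
rewrite (_ : [set w | _] = \bigcup_n
    ((fun w => runmax (S ^~ w) (a n) (c n)) @^-1` `[0, +oo[%classic)).
  apply: bigcup_measurable => n _; rewrite -[X in measurable X]setTI.
  suff mS : measurable_fun setT (fun w => runmax (S ^~ w) (a n) (c n)).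
    by apply: mS => //; exact: measurable_itv.
  apply: measurable_runmax => // s /andP[as_ _]; apply: measurableT_comp => //.
  apply: measurable_sum => i; apply: mZ.
  exact: le_trans (ltW (a0 n)) as_.
apply/seteqP; split=> w /=.
  move=> [t t0 Zt].
  pose n := maxn (Num.bound t) (Num.bound t^-1); exists n => //=.
  rewrite in_itv /= andbT.
  have <- : S t w = 0 by rewrite /S big1 ?oppr0.
  apply: (runmax_ge (cS w)); apply/andP; split.
    rewrite /a -[leRHS]invrK lef_pV2 ?posrE ?invr_gt0 ?ltr0n //.
    apply: le_trans (ltW (archi_boundP _)) _; first by rewrite invr_ge0 ltW.
    by rewrite ler_nat leqW // leq_maxr.
  apply: le_trans (ltW (archi_boundP (ltW t0))) _.
  by rewrite ler_nat leqW // leq_maxl.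
move=> [n _] /=; rewrite in_itv /= andbT.
have [t /andP[at_ _] [-> _]] := runmaxP (ac n) (cS w).
have t0 : 0 < t by exact: lt_le_trans at_.
rewrite oppr_ge0 => S0; exists t => // i.
have /eqP : \sum_i Z i t w == 0.
  by rewrite eq_le S0 sumr_ge0 // => j _; apply: Z0; exact: ltW.
by move/psumr_eq0P => -> // j _; apply: Z0; exact: ltW.
Qed.

(** * Independence of the increments *)

Lemma measurable_wrtP (R : realType) (d : measure_display) (T : measurableType d)
    (G : set (set T)) (X : T -> R) :
  measurable_wrt <<s G >> X <-> measurable_fun setT (X : g_sigma_algebraType G -> R).
Proof.
split=> [mX _ U mU|mX U mU]; first by rewrite setTI; exact: mX.
by rewrite -[X in <<s G >> X]setTI; exact: mX.
Qed.

(** Two finite measures, D -> P(D [&] E) and D -> P(E) P(D), agree on the pi-system [C]. *)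
Lemma indep_sigma_algebra (R : realType) (d : measure_display)
    (T : measurableType d) (P : probability T R) (E : set T) (C : set (set T)) :
  measurable E -> C `<=` measurable -> setI_closed C -> C setT ->
  (forall D, C D -> P (E `&` D) = (P E * P D)%E) ->
  forall D, <<s C >> D -> P (E `&` D) = (P E * P D)%E.
Proof.
move=> mE mC CI CT indC D sD.
have PE0 : 0 <= fine (P E) by rewrite fine_ge0.
have PEE : P E = (fine (P E))%:E by rewrite fineK // fin_num_measure.
rewrite setIC PEE.
apply: (@g_sigma_algebra_measure_unique _ R T C mC (fun _ => setT) (fun _ => CT) _
  (mrestr P mE) (mscale (NngNum PE0) P) CI _ _ D sD).
- exact: bigcup_const.
- by move=> A CA; transitivity (P (A `&` E)); rewrite // setIC indC // {1}PEE.
- move=> _; apply: le_lt_trans (probability_le1 P _) (ltry 1).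
  exact: measurableI.
Qed.

Section IncrementIndependence.
Context (R : realType) (d : measure_display) (T : measurableType d).
Context (P : probability T R) (n : nat) (F : R -> set (set T)).
Context (B : R -> T -> 'cV[R]_n) (mu : 'cV[R]_n) (A : 'M[R]_n) (z : 'cV[R]_n).
Context (q : R).
Hypothesis filtF : filtration F.
Hypothesis bmB : brownian_motion P F B mu A z.
Hypothesis q_ge0 : 0 <= q.

(** Each event involves one time and one coordinate, so this is in general not a pi-system; finite
    intersections appear only in the generated sigma-algebra. *)
Definition incr_gen (S : set R) : set (set T) :=
  [set E | exists s i U, [/\ S s, measurable U &
    E = (fun w => (B s w - B q w) i 0) @^-1` U]].

Lemma incr_gen_measurable (S : set R) s i : S s ->
  measurable_fun setT
    ((fun w => (B s w - B q w) i 0) : g_sigma_algebraType (incr_gen S) -> R).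
Proof.
by move=> Ss; apply/measurable_wrtP => U mU; apply: sub_sigma_algebra; exists s, i, U.
Qed.

Lemma adapted_increment r s t i : 0 <= r -> r <= s -> s <= t ->
  measurable_fun setT
    ((fun w => (B s w - B r w) i 0) : g_sigma_algebraType (F t) -> R).
Proof.
have [_ [_ mB] _ _] := bmB; have [sF _ mono] := filtF => r0 rs st.
have s0 : 0 <= s by exact: le_trans rs.
have mFB x : 0 <= x -> x <= t ->
    measurable_fun setT ((fun w => B x w i 0) : g_sigma_algebraType (F t) -> R).
  move=> x0 xt; apply/measurable_wrtP => U mU; apply: sub_sigma_algebra.
  by apply: (mono x) => //; exact: mB.
rewrite (_ : (fun w => _) = fun w => B s w i 0 - B r w i 0); last first.
  by apply/funext => w; rewrite !mxE.
by apply: measurable_funB; apply: mFB => //; exact: le_trans st.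
Qed.

Lemma sub_filtration_incr (S : set R) t : q <= t ->
  (forall s, S s -> q <= s <= t) -> <<s incr_gen S >> `<=` F t.
Proof.
move=> qt St; have [sF _ _] := filtF.
apply: smallest_sub; first exact: sF.
move=> _ [s [i [U [Ss mU ->]]]]; have /andP[qs st] := St s Ss.
have /measurable_wrtP := adapted_increment i q_ge0 qs st.
by rewrite (sigma_algebra_id (sF t)); apply.
Qed.

Lemma measurable_incr (S : set R) :
  (forall s, S s -> q <= s) -> <<s incr_gen S >> `<=` measurable.
Proof.
move=> Sq; have [sF mF _] := filtF.
apply: smallest_sub; first exact: sigma_algebra_measurable.
move=> _ [s [i [U [Ss mU ->]]]]; apply: (mF s).
have /measurable_wrtP := adapted_increment i q_ge0 (Sq s Ss) (lexx s).
by rewrite (sigma_algebra_id (sF s)); apply.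
Qed.

Lemma incr_event_algebra (C : set (set T)) s t i :
  (forall U : 'I_n -> set R, (forall i, measurable (U i)) -> C (incr_event B s t U)) ->
  measurable_fun setT
    ((fun w => (B t w - B s w) i 0) : g_sigma_algebraType C -> R).
Proof.
move=> CU; apply/measurable_wrtP => U mU; apply: sub_sigma_algebra.
rewrite (_ : _ @^-1` _ = incr_event B s t (fun j => if j == i then U else setT)).
  by apply: CU => j; case: ifP.
apply/seteqP; split=> w /= h; last by have := h i; rewrite eqxx.
by move=> j; case: eqP => // ->.
Qed.

Lemma incr_event_setT s t : incr_event B s t (fun _ => setT) = setT.
Proof. exact/seteqP. Qed.

Lemma incr_gen_sub (S S' : set R) : S `<=` S' ->
  <<s incr_gen S >> `<=` <<s incr_gen S' >>.
Proof.
move=> SS; apply: sub_sigma_algebra2 => _ [s [i [U [Ss mU ->]]]].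
by exists s, i, U; split=> //; exact: SS.
Qed.

(* Adding a time t to a set of times with maximum s: the new events are
   generated by the old ones and the increment over [s, t]. *)
Lemma indep_incr_step (S : set R) s t : q <= s -> s < t ->
  (forall r, S r -> q <= r <= s) -> (q < s -> S s) ->
  (forall E D, F q E -> <<s incr_gen S >> D -> P (E `&` D) = (P E * P D)%E) ->
  forall E D, F q E -> <<s incr_gen (S `|` [set t]) >> D ->
    P (E `&` D) = (P E * P D)%E.
Proof.
have [sF mF mono] := filtF; have [_ _ _ indB] := bmB.
move=> qs st Sqs Ss IH E D FE; have s0 : 0 <= s by exact: le_trans qs.
have SF : <<s incr_gen S >> `<=` F s by exact: sub_filtration_incr.
(* This is a pi-system. For such an event, E [&] D1 lies in F(s), so the increment over [s, t]
   factors out, and the hypothesis on [S] separates E from D1. *)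
pose C := [set X | exists D1 U, [/\ <<s incr_gen S >> D1,
  (forall i, measurable (U i)) & X = D1 `&` incr_event B s t U]].
have sST : <<s incr_gen S >> setT.
  by have [] := @smallest_sigma_algebra _ setT (incr_gen S) => ? + _ => /(_ set0); rewrite setD0; apply.
have CU U : (forall i, measurable (U i)) -> C (incr_event B s t U).
  by move=> mU; exists setT, U; rewrite setTI.
have CS D1 : <<s incr_gen S >> D1 -> C D1.
  by move=> sD1; exists D1, (fun _ => setT); rewrite incr_event_setT setIT.
have IC : setI_closed C.
  move=> _ _ [D1 [U [sD1 mU ->]]] [D2 [V [sD2 mV ->]]].
  exists (D1 `&` D2), (fun i => U i `&` V i); split.
  - exact: (@measurableI _ (g_sigma_algebraType (incr_gen S))).
  - by move=> i; exact: measurableI.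
  - rewrite setIACA; congr (_ `&` _); apply/seteqP; split=> w /=.
      by move=> [h1 h2] i; split.
    by move=> h; split=> i; have [] := h i.
have mI U : (forall i, measurable (U i)) -> measurable (incr_event B s t U).
  move=> mU; rewrite (_ : incr_event _ _ _ _ =
    \bigcap_(i in [set: 'I_n]) ((fun w => (B t w - B s w) i 0) @^-1` U i)).
    apply: fin_bigcap_measurable => // i _; apply: (mF t).
    have /measurable_wrtP := adapted_increment i s0 (ltW st) (lexx t).
    by rewrite (sigma_algebra_id (sF t)); apply.
  by apply/seteqP; split=> w h i //=; exact: h.
have indC X : C X -> P (E `&` X) = (P E * P X)%E.
  move=> [D1 [U [sD1 mU ->]]]; rewrite setIA !indB //; last 2 first.
  - exact: SF.
  - have FsE : F s E by exact: (mono q s).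
    rewrite -(sigma_algebra_id (sF s)).
    apply: (@measurableI _ (g_sigma_algebraType (F s))); apply: sub_sigma_algebra => //.
    exact: SF.
  by rewrite IH // muleA.
have genC : incr_gen (S `|` [set t]) `<=` <<s C >>.
  have mCS r i : S r -> measurable_fun setT
      ((fun w => (B r w - B q w) i 0) : g_sigma_algebraType C -> R).
    move=> Sr; apply/measurable_wrtP => U mU; apply: sub_sigma_algebra; apply: CS.
    by apply: sub_sigma_algebra; exists r, i, U.
  have mCq i : measurable_fun setT
      ((fun w => (B s w - B q w) i 0) : g_sigma_algebraType C -> R).
    (* If s = q, then [S] may not contain s, but B(s) - B(q) is zero. *)
    have [qs'|sq] := ltP q s; first by apply: mCS; exact: Ss.
    have -> : s = q by apply/eqP; rewrite eq_le sq.
    rewrite (_ : (fun w => _) = cst 0); first exact: measurable_cst.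
    by apply/funext => w; rewrite subrr mxE.
  have mCt i : measurable_fun setT
      ((fun w => (B t w - B q w) i 0) : g_sigma_algebraType C -> R).
    rewrite (_ : (fun w => _) =
      fun w => (B t w - B s w) i 0 + (B s w - B q w) i 0); last first.
      by apply/funext => w; rewrite !mxE; lra.
    by apply: measurable_funD; [exact: incr_event_algebra|exact: mCq].
  move=> _ [r [i [U [[Sr|->] mU ->]]]].
    by have /measurable_wrtP := mCS r i Sr; apply.
  by have /measurable_wrtP := mCt i; apply.
move=> sD; apply: (@indep_sigma_algebra _ _ _ _ _ C) => //.
- exact: mF FE.
- move=> _ [D1 [U [sD1 mU ->]]]; apply: measurableI; last exact: mI.
  exact: (mF s _ (SF _ sD1)).
- exact: CS.
- by apply: smallest_sub sD => //; exact: smallest_sigma_algebra.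
Qed.

(** Induction on the number of times: in decreasing order the head is the time to add, and the next
    entry is the maximum of the others, or q when there are none. *)
Lemma indep_incr_seq (l : seq R) : sorted >%R l -> (forall s, s \in l -> q < s) ->
  forall E D, F q E -> <<s incr_gen [set` l] >> D -> P (E `&` D) = (P E * P D)%E.
Proof.
elim: l => [|t l IH] sl ql.
  move=> E D FE sD; apply: (@indep_sigma_algebra _ _ _ _ _ [set setT]) => //.
  - by have [_ mF _] := filtF; exact: mF FE.
  - by move=> _ ->; exact: measurableT.
  - by move=> _ _ -> ->; rewrite setIT.
  - by move=> _ ->; rewrite setIT probability_setT mule1.
  - by apply: sub_sigma_algebra2 sD => X [s [i [U []]]].
have -> : [set` t :: l] = [set` l] `|` [set t].
  by apply/seteqP; split=> r /=; rewrite inE;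
    [case/orP => [/eqP|]; [right|left]|case=> [->|->]; rewrite ?eqxx ?orbT].
have sl' : sorted >%R l by exact: path_sorted sl.
have {}IH := IH sl' (fun s sl => ql s (mem_behead (s := t :: l) sl)).
case: l => [|x l] in sl ql sl' IH *.
  by apply: (@indep_incr_step _ q) => //; [exact: ql (mem_head _ _)|rewrite ltxx].
have qx : q < x by apply: ql; rewrite !inE eqxx orbT.
apply: (@indep_incr_step _ x) => //.
- exact: ltW.
- by case/andP: sl.
- move=> r /= rl; apply/andP; split.
    by apply/ltW/ql; rewrite in_cons rl orbT.
  move: rl; rewrite inE => /predU1P[->//|rl]; apply: ltW.
  by move: sl' => /= /order_path_min/allP; apply => // a b c ab bc; exact: lt_trans ab.
- by move=> _ /=; rewrite inE eqxx.
Qed.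

(** The events that depend on finitely many times after q form a pi-system generating all of
    them. *)
Lemma indep_increments E D : F q E -> <<s incr_gen [set s | q < s] >> D ->
  P (E `&` D) = (P E * P D)%E.
Proof.
move=> FE sD; have [sF mF _] := filtF.
pose C := [set X | exists2 l : seq R, (forall s, s \in l -> q < s) &
  <<s incr_gen [set` l] >> X].
have mC X : C X -> exists2 l : seq R, sorted >%R l /\ (forall s, s \in l -> q < s) &
    <<s incr_gen [set` l] >> X.
  move=> [l ql lX]; exists (rev (sort <=%O (undup l))).
    split=> [|s]; last by rewrite mem_rev mem_sort mem_undup; exact: ql.
    by rewrite rev_sorted sort_lt_sorted undup_uniq.
  by apply: incr_gen_sub lX => s /=; rewrite mem_rev mem_sort mem_undup.
apply: (@indep_sigma_algebra _ _ _ _ _ C).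
- exact: mF FE.
- by move=> X [l ql lX]; apply: measurable_incr lX => s sl; rewrite ltW ?ql.
- move=> X Y [l ql lX] [k qk kY]; exists (l ++ k).
    by move=> s; rewrite mem_cat => /orP[/ql|/qk].
  apply: (@measurableI _ (g_sigma_algebraType (incr_gen [set` l ++ k]))).
    by apply: incr_gen_sub lX => s /=; rewrite mem_cat => ->.
  by apply: incr_gen_sub kY => s /=; rewrite mem_cat => ->; rewrite orbT.
- by exists [::] => //; exact: (@measurableT _ (g_sigma_algebraType (incr_gen [set` [::]]))).
- by move=> X /mC[l [sl ql] lX]; exact: (indep_incr_seq sl ql).
- apply: sub_sigma_algebra2 sD => _ [s [i [U [/= qs mU ->]]]].
  exists [:: s]; first by move=> r; rewrite inE => /eqP ->.
  by apply: sub_sigma_algebra; exists s, i, U; split=> //=; rewrite inE.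
Qed.
End IncrementIndependence.

(** Independence makes the joint law the product of the two laws, and by Fubini the mass of H is the
    integral of the masses of its sections. *)
Lemma indep_xsection_null (R : realType) (d d1 d2 : measure_display)
    (T : measurableType d) (T1 : measurableType d1) (T2 : measurableType d2)
    (P : probability T R) (f1 : T -> T1) (f2 : T -> T2) (H : set (T1 * T2)) :
  measurable_fun setT f1 -> measurable_fun setT f2 ->
  (forall A1 A2, measurable A1 -> measurable A2 ->
     P (f1 @^-1` A1 `&` f2 @^-1` A2) = (P (f1 @^-1` A1) * P (f2 @^-1` A2))%E) ->
  measurable H -> (forall x, P (f2 @^-1` xsection H x) = 0%E) ->
  P ((fun w => (f1 w, f2 w)) @^-1` H) = 0%E.
Proof.
move=> mf1 mf2 ind mH H0.
pose f w := (f1 w, f2 w).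
have mf : measurable_fun setT f by exact: measurable_fun_pair.
pose X1 : {mfun T >-> T1} := HB.pack f1 (isMeasurableFun.Build _ _ _ _ f1 mf1).
pose X2 : {mfun T >-> T2} := HB.pack f2 (isMeasurableFun.Build _ _ _ _ f2 mf2).
pose X : {mfun T >-> (T1 * T2)%type} := HB.pack f (isMeasurableFun.Build _ _ _ _ f mf).
have <- : (distribution P X1 \x distribution P X2)%E H = P (f @^-1` H).
  exact: (@product_measure_unique _ _ _ _ _ _ _ (distribution P X)).
rewrite /product_measure1 /=; apply: integral0_eq => x _.
exact: H0.
Qed.

Lemma negligible_countable (R : realType) (d : measure_display)
    (T : measurableType d) (P : probability T R) (K : countType) (N : K -> set T) :
  (forall k, P.-negligible (N k)) -> P.-negligible [set w | exists k, N k w].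
Proof.
move=> N0; apply: (@negligibleS _ _ _ _
    (\bigcup_n oapp N set0 (unpickle n : option K))).
  by move=> w [k Nk]; exists (pickle k) => //; rewrite pickleK.
apply: negligible_bigcup => n; case: unpickle => [k|] /=; first exact: N0.
exact: negligible_set0.
Qed.

(** * The reflected process of a subset of coordinates *)

Section LocalReflectedProcess.
Context (R : realType) (d : measure_display) (T : measurableType d).
Context (P : probability T R) (n : nat) (F : R -> set (set T)).
Context (B : R -> T -> 'cV[R]_n) (mu : 'cV[R]_n) (A Rm : 'M[R]_n) (z : 'cV[R]_n).
Context (q : R) (u : 'I_n -> R) (I : {set 'I_n}).
Hypothesis filtF : filtration F.
Hypothesis bmB : brownian_motion P F B mu A z.
Hypothesis q_ge0 : 0 <= q.
Hypothesis Q_ge0 : forall i j, 0 <= (1%:M - Rm) i j.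
Hypothesis u_gt0 : forall i, 0 < u i.
Hypothesis uE : forall i, 1 + \sum_j (1%:M - Rm) i j * u j = u i.

Definition loc_Q : 'M[R]_#|I| := 1%:M - submx_I I Rm.

Lemma loc_QE i j : loc_Q i j = (1%:M - Rm) (enum_val i) (enum_val j).
Proof. by rewrite !mxE (inj_eq enum_val_inj). Qed.

Lemma loc_Q_ge0 i j : 0 <= loc_Q i j.
Proof. by rewrite loc_QE. Qed.

(** Dropping the nonnegative terms outside I turns the equation for u into an inequality, the form
    assumed for the Skorokhod problem. *)
Lemma loc_u_dom i :
  1 + \sum_j loc_Q i j * u (enum_val j) <= u (enum_val i).
Proof.
rewrite -uE lerD2l; under eq_bigr do rewrite loc_QE.
rewrite -(big_enum_val (fun k => (1%:M - Rm) (enum_val i) k * u k)) /=.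
rewrite [leRHS](bigID [in I]) /= lerDl; apply: sumr_ge0 => k _.
by rewrite mulr_ge0 // ltW.
Qed.

(** The start x is a parameter separate from B, so that it can be frozen or replaced by [Z(q)]_I. *)
Definition loc_drive (x : 'cV[R]_#|I|) (i : 'I_#|I|) (t : R) (w : T) : R :=
  x i 0 + (B (q + Num.max t 0) w - B q w) (enum_val i) 0.

Definition loc_L (x : 'cV[R]_#|I|) (i : 'I_#|I|) (t : R) (w : T) : R :=
  sk_reg loc_Q (fun j r => loc_drive x j r w) i t.

Definition loc_Z (x : 'cV[R]_#|I|) (i : 'I_#|I|) (t : R) (w : T) : R :=
  sk_path loc_Q (fun j r => loc_drive x j r w)
    (sk_reg loc_Q (fun j r => loc_drive x j r w)) i t.

Lemma continuous_loc_drive x w i : continuous (fun t => loc_drive x i t w).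
Proof.
have [_ [cB _] _ _] := bmB.
rewrite (_ : (fun t => _) = (fun t : R => x i 0 +
    (B (q + Num.max t 0) w (enum_val i) 0 - B q w (enum_val i) 0))).
  move=> t; apply: cvgD; first exact: cvg_cst.
  by apply: cvgB; [exact: (continuous_shift q_ge0 (cB w _))|exact: cvg_cst].
by apply/funext => t; rewrite /loc_drive !mxE.
Qed.

Lemma loc_drive0 x i w : loc_drive x i 0 w = x i 0.
Proof. by rewrite /loc_drive maxxx addr0 subrr mxE addr0. Qed.

Lemma measurable_loc_drive x i s t : 0 <= s <= t ->
  measurable_fun setT (loc_drive x i s : g_sigma_algebraType (F (q + t)) -> R).
Proof.
move=> /andP[s0 st]; apply: measurable_funD; first exact: measurable_cst.
rewrite max_l //; apply: (adapted_increment filtF bmB) => //.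
- by rewrite lerDl.
- by rewrite lerD2l.
Qed.

Section Start.
Variable x : 'cV[R]_#|I|.
Hypothesis x_ge0 : orthant x.

Let uI (i : 'I_#|I|) : R := u (enum_val i).

Let uI0 i : 0 < uI i. Proof. exact: u_gt0. Qed.

Let uI_dom i : 1 + \sum_j loc_Q i j * uI j <= uI i.
Proof. exact: loc_u_dom. Qed.

Let b0 w i : 0 <= loc_drive x i 0 w.
Proof. by rewrite loc_drive0. Qed.

Lemma continuous_loc_L w i : continuous (fun t => loc_L x i t w).
Proof.
exact: (continuous_sk_reg loc_Q_ge0 uI0 uI_dom
  (@continuous_loc_drive x w) (b0 w)).
Qed.

Lemma continuous_loc_Z w i : continuous (fun t => loc_Z x i t w).
Proof.
exact: (continuous_sk_path loc_Q_ge0 uI0 uI_dom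
  (@continuous_loc_drive x) b0).
Qed.

Lemma loc_Z_ge0 w i t : 0 <= t -> 0 <= loc_Z x i t w.
Proof.
exact: (sk_reg_feasible loc_Q_ge0 uI0 uI_dom
  (@continuous_loc_drive x w) (b0 w)).
Qed.

Lemma loc_brownian_motion :
  brownian_motion P (fun t => F (q + t))
    (fun t w => x + subvec I (B (q + t) w - B q w)) (subvec I mu) (submx_I I A) x.
Proof.
have [sF mF mono] := filtF; have [_ _ normB indB] := bmB; split.
- by move=> w; rewrite addr0 subrr; apply/colP => i; rewrite !mxE addr0.
- split=> [w i|t i t0].
    apply/within_ge0_continuous.
    rewrite (_ : (fun t => _) = fun t => loc_drive x i t w).
      exact: continuous_loc_drive.
    by apply/funext => t; rewrite /loc_drive !mxE.
  have /measurable_wrtP := @measurable_loc_drive x i t t (introT andP (conj t0 (lexx t))).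
  rewrite (sigma_algebra_id (sF _)).
  rewrite (_ : loc_drive x i t = (fun w => (x + subvec I (B (q + t) w - B q w)) i 0)) //.
  by apply/funext => w; rewrite /loc_drive max_l // !mxE.
- move=> s t v s0 st v0 U mU.
  (* Extension of v by zero outside I: a linear functional of [B]_I becomes one of B, with the same
     mean and variance. *)
  pose v' : 'cV[R]_n := \col_k (if pselect (exists i, enum_val i = k) is left e
     then v (projT1 (cid e)) 0 else 0).
  have v'E i : v' (enum_val i) 0 = v i 0.
    rewrite mxE; case: pselect => [e|]; last by case; exists i.
    by case: cid => j /= /enum_val_inj ->.
  have v'N k : k \notin I -> v' k 0 = 0.
    move=> kI; rewrite mxE; case: pselect => // e; exfalso.
    by move: kI; have [i <-] := e; rewrite enum_valP.
  have sumE (f : 'I_n -> R) : \sum_k v' k 0 * f k = \sum_i v i 0 * f (enum_val i).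
    rewrite (bigID [in I]) /= [X in _ + X]big1 ?addr0 => [|k /v'N ->]; last by rewrite mul0r.
    by rewrite big_enum_val /=; apply: eq_bigr => i _; rewrite v'E.
  have v'0 : v' != 0.
    apply: contra_neq v0 => v'0; apply/colP => i.
    by rewrite -v'E v'0 !mxE.
  have dotE (y : 'cV[R]_n) : (v'^T *m y) 0 0 = (v^T *m subvec I y) 0 0.
    rewrite !mxE (eq_bigr (fun k => v' k 0 * y k 0)); last by move=> k _; rewrite mxE.
    by rewrite sumE; apply: eq_bigr => i _; rewrite !mxE.
  have quadE : (v'^T *m A *m v') 0 0 = (v^T *m submx_I I A *m v) 0 0.
    rewrite -!mulmxA dotE; congr ((_ *m _) 0 0); apply/colP => i; rewrite !mxE.
    under eq_bigr do rewrite mulrC.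
    by rewrite sumE; apply: eq_bigr => j _; rewrite !mxE mulrC.
  have qs0 : 0 <= q + s by exact: addr_ge0.
  have qst : q + s < q + t by rewrite ltrD2l.
  rewrite (_ : (fun w => _) =
    (fun w => (v'^T *m (B (q + t) w - B (q + s) w)) 0 0)); last first.
    apply/funext => w; rewrite dotE; congr ((_ *m _) 0 0); apply/colP => i.
    by rewrite !mxE; ring.
  rewrite (normB _ _ v' qs0 qst v'0 U mU) dotE quadE.
  by rewrite (_ : q + t - (q + s) = t - s) //; ring.
move=> s t s0 st E U FE mU.
(* At most one i satisfies [enum_val i = k]; for k outside I the intersection is empty and [U' k] is
   all of R. *)
pose U' k : set R := \bigcap_(i in [set i | enum_val i = k]) U i.
have -> : incr_event (fun t w => x + subvec I (B (q + t) w - B q w)) s t U =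
    incr_event B (q + s) (q + t) U'.
  apply/seteqP; split=> w h.
    move=> k i /= <-; have := h i; congr (U i _); rewrite !mxE; ring.
  move=> i; have := h (enum_val i) i erefl; congr (U i _); rewrite !mxE; ring.
have qs0 : 0 <= q + s by exact: addr_ge0.
have qst : q + s < q + t by rewrite ltrD2l.
apply: (indB _ _ qs0 qst E U' FE) => k.
by apply: fin_bigcap_measurable => //; exact: finite_finset.
Qed.

Lemma loc_is_SRBM :
  is_SRBM P (fun t => F (q + t)) (fun t w => \col_i loc_Z x i t w)
    (submx_I I Rm) (subvec I mu) (submx_I I A) x.
Proof.
have [sF mF mono] := filtF.
exists (fun t w => x + subvec I (B (q + t) w - B q w)), (fun t w => \col_i loc_L x i t w).
split.
- exact: loc_brownian_motion.
- split=> [w i|t i t0].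
    rewrite (_ : (fun t => _) = fun t => loc_Z x i t w); last by apply/funext => t; rewrite mxE.
    by apply: continuous_subspaceT; exact: continuous_loc_Z.
  have := @measurable_sk_path _ _ loc_Q uI _ (g_sigma_algebraType (F (q + t)))
    (loc_drive x) loc_Q_ge0 uI0 uI_dom (@continuous_loc_drive x) b0 t i
    (fun j s st => measurable_loc_drive x j st) t0.
  move=> /measurable_wrtP; rewrite (sigma_algebra_id (sF _)).
  by congr measurable_wrt; apply/funext => w; rewrite mxE.
- by move=> t w t0 i; rewrite mxE; exact: loc_Z_ge0.
- move=> t w t0; apply/colP => i; rewrite !mxE.
  rewrite /loc_Z (sk_pathE _ _ _ _ (C := submx_I I Rm)) // /loc_drive max_l // !mxE.
  by congr (_ + _); apply: eq_bigr => j _; rewrite [(\col_k _) j 0]mxE.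
split.
  split=> [w i|t i t0].
    rewrite (_ : (fun t => _) = fun t => loc_L x i t w); last by apply/funext => t; rewrite mxE.
    by apply: continuous_subspaceT; exact: continuous_loc_L.
  have := @measurable_sk_reg _ _ loc_Q uI _ (g_sigma_algebraType (F (q + t)))
    (loc_drive x) loc_Q_ge0 uI0 uI_dom (@continuous_loc_drive x) b0 t i
    (fun j s st => measurable_loc_drive x j st) t0.
  move=> /measurable_wrtP; rewrite (sigma_algebra_id (sF _)).
  by congr measurable_wrt; apply/funext => w; rewrite mxE.
move=> w k.
have ndL s t : 0 <= s -> s <= t -> loc_L x k s w <= loc_L x k t w.
  exact: (sk_reg_nondecreasing loc_Q_ge0 uI0 uI_dom (@continuous_loc_drive x w) (b0 w)).
split.
- by rewrite mxE; exact: (sk_reg0 loc_Q_ge0 uI0 uI_dom (@continuous_loc_drive x w) (b0 w)).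
- by move=> s t s0 st; rewrite !mxE; exact: ndL.
rewrite (_ : (fun t => (\col_i loc_Z x i t w) k 0) = fun t => loc_Z x k t w); last by apply/funext => t; rewrite mxE.
rewrite (_ : (fun t => (\col_i loc_L x i t w) k 0) = fun t => loc_L x k t w); last by apply/funext => t; rewrite mxE.
apply: flat_stieltjes_int0 => //.
- apply/within_ge0_continuous; apply: continuous_subspaceT; exact: continuous_loc_Z.
- by move=> t; exact: loc_Z_ge0.
- apply/within_ge0_continuous; apply: continuous_subspaceT; exact: continuous_loc_L.
- exact: (sk_reg_flat loc_Q_ge0 uI0 uI_dom (@continuous_loc_drive x w) (b0 w)).
Qed.
End Start.
End LocalReflectedProcess.

(** The start is F_q-measurable and the driving increments are independent of F_q, so it suffices
    that sections be null; the section over x is the corner event of the SRBM started at the fixed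
    point X(x). *)
Lemma loc_Z_random_start_negligible (R : realType) (d : measure_display)
    (T : measurableType d) (P : probability T R) (n : nat) (F : R -> set (set T))
    (B : R -> T -> 'cV[R]_n) (mu : 'cV[R]_n) (A Rm : 'M[R]_n) (z : 'cV[R]_n)
    (q : R) (u : 'I_n -> R) (I : {set 'I_n}) (X : T -> 'cV[R]_#|I|) :
  filtration F -> brownian_motion P F B mu A z -> 0 <= q ->
  (forall i j, 0 <= (1%:M - Rm) i j) -> (forall i, 0 < u i) ->
  (forall i, 1 + \sum_j (1%:M - Rm) i j * u j = u i) ->
  (forall w, orthant (X w)) ->
  (forall i, measurable_wrt (F q) (fun w => X w i 0)) ->
  SRBM_not_hit_corner (submx_I I Rm) (subvec I mu) (submx_I I A) ->
  P.-negligible [set w | exists2 t, 0 < t & forall i, loc_Z B Rm q (X w) i t w = 0].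
Proof.
move=> filtF bmB q0 Q0 u0 uE X0 mX nohit.
have [sF mF mono] := filtF.
pose S := incr_gen B q [set s | q < s].
(* The same sample space carries the past and the increments as two sigma-algebras; the diagonal map
   w -> (w, w) then separates the start from the noise. *)
pose T1 := g_sigma_algebraType (F q); pose T2 := g_sigma_algebraType S.
pose drive i t (p : T1 * T2) := loc_drive B q (X p.1) i t p.2.
pose H : set (T1 * T2) :=
  [set p | exists2 t, 0 < t & forall i, loc_Z B Rm q (X p.1) i t p.2 = 0].
have uI0 (i : 'I_#|I|) : 0 < u (enum_val i) by [].
have cdrive (p : T1 * T2) i : continuous (fun t => drive i t p).
  exact: (continuous_loc_drive bmB q0).
have drive0 (p : T1 * T2) i : 0 <= drive i 0 p.
  by rewrite /drive loc_drive0; exact: X0.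
have mdrive i t : measurable_fun setT (drive i t).
  apply: measurable_funD.
    apply: (@measurableT_comp _ _ _ _ _ _ (fun w : T1 => X w i 0)).
      by apply/measurable_wrtP; rewrite (sigma_algebra_id (sF q)).
    exact: measurable_fst.
  (* The generators [S] contain only times after q; for t <= 0 the clamped increment is zero. *)
  have [t0|t0] := ltP 0 t; last first.
    rewrite (_ : (fun p => _) = cst 0); first exact: measurable_cst.
    by apply/funext => p; rewrite addr0 subrr mxE.
  apply: (@measurableT_comp _ _ _ _ _ _ (fun w : T2 =>
    (B (q + t) w - B q w) (enum_val i) 0)).
    by apply: incr_gen_measurable; rewrite /= ltrDl.
  exact: measurable_snd.
have mH : measurable H.
  apply: measurable_hits0.
  - by move=> p i; exact: (continuous_loc_Z bmB q0 Q0 u0 uE (X0 _)).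
  - by move=> p i t; exact: (loc_Z_ge0 bmB q0 Q0 u0 uE (X0 _)).
  - move=> i t t0; apply: (@measurable_sk_path _ _ _ _ _ _ drive _ uI0) => //.
    + exact: loc_Q_ge0.
    + exact: (loc_u_dom Q0 u0 uE).
have subT1 (Y : set T) : <<s F q >> Y -> measurable Y.
  by rewrite (sigma_algebra_id (sF q)); exact: mF.
have subT2 (Y : set T) : <<s S >> Y -> measurable Y.
  by apply: (measurable_incr filtF bmB q0) => s /ltW.
pose f1 : T -> T1 := id; pose f2 : T -> T2 := id.
have mf1 : measurable_fun setT f1 by move=> _ Y mY; rewrite setTI; exact: subT1.
have mf2 : measurable_fun setT f2 by move=> _ Y mY; rewrite setTI; exact: subT2.
have mf : measurable_fun setT (fun w => (f1 w, f2 w)) by exact: measurable_fun_pair.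
apply: (@negligibleS _ _ _ _ ((fun w => (f1 w, f2 w)) @^-1` H)) => //.
apply/negligibleP.
  by rewrite -[X in measurable X]setTI; exact: mf.
apply: indep_xsection_null => //.
- move=> A1 A2 mA1 mA2; apply: (indep_increments filtF bmB q0) => //.
  by rewrite -(sigma_algebra_id (sF q)).
move=> x; apply/negligibleP.
  by apply: subT2; exact: (@measurable_xsection _ _ T1 T2 H x mH).
have filtFq : filtration (fun t => F (q + t)).
  split=> // s t s0 st; apply: mono; first exact: addr_ge0.
  by rewrite lerD2l.
have := nohit _ _ P _ _ _ filtFq (X0 x) (loc_is_SRBM filtF bmB q0 Q0 u0 uE (X0 x)).
apply: negligibleS => w; rewrite /f2 /= => /xsectionP[t t0 Zt]; exists t; split=> //.
split=> [i|i _]; rewrite mxE; last exact: Zt.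
by rewrite Zt.
Qed.

(** * Pathwise reduction of face hitting to corner hitting *)

Section FaceHittingPath.
Context (R : realType) (d : measure_display) (T : measurableType d).
Context (P : probability T R) (n : nat) (F : R -> set (set T)).
Context (B Z L : R -> T -> 'cV[R]_n) (mu : 'cV[R]_n) (A Rm : 'M[R]_n) (z : 'cV[R]_n).
Context (u : 'I_n -> R).
Hypothesis filtF : filtration F.
Hypothesis bmB : brownian_motion P F B mu A z.
Hypothesis Q_ge0 : forall i j, 0 <= (1%:M - Rm) i j.
Hypothesis u_gt0 : forall i, 0 < u i.
Hypothesis uE : forall i, 1 + \sum_j (1%:M - Rm) i j * u j = u i.
Hypothesis Z_cont : cont_adapted F Z.
Hypothesis Z_ge0 : forall t w, 0 <= t -> orthant (Z t w).
Hypothesis ZE : forall t w, 0 <= t -> Z t w = B t w + Rm *m L t w.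
Hypothesis L_cont : cont_adapted F L.
Hypothesis L_reg : forall w k, [/\ L 0 w k 0 = 0,
  (forall s t, 0 <= s -> s <= t -> L s w k 0 <= L t w k 0)
  & stieltjes_int0 (fun t => Z t w k 0) (fun t => L t w k 0)].

Lemma SRBM_flat w k a c : 0 <= a -> a <= c ->
  (forall r, a <= r <= c -> 0 < Z r w k 0) -> L c w k 0 = L a w k 0.
Proof.
have [_ _ intL] := L_reg w k; have [cZ _] := Z_cont.
apply: (@stieltjes_int0_flat _ (fun t => Z t w k 0) (fun t => L t w k 0)) => //.
  by apply/(within_ge0_continuous (fun t => Z t w k 0)); exact: cZ.
by move=> t t0; exact: Z_ge0.
Qed.

(** Regulators outside I do not move on [q, t] and drop out of the increment of R L. Both the
    increments of [L]_I and the constructed regulator meet the hypotheses of [sk_minimal] on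
    [0, t - q]; exchanging their roles gives equality. *)
Lemma loc_Z_eq w (I : {set 'I_n}) q t : 0 <= q -> q <= t ->
  (forall j r, j \notin I -> q <= r <= t -> 0 < Z r w j 0) ->
  forall i : 'I_#|I|,
    loc_Z B Rm q (subvec I (Z q w)) i (t - q) w = Z t w (enum_val i) 0.
Proof.
move=> q0 qt Zpos; pose x := subvec I (Z q w).
pose b i r := loc_drive B q x i r w.
pose l (i : 'I_#|I|) s := L (q + Num.max s 0) w (enum_val i) 0 - L q w (enum_val i) 0.
have x0 : orthant x by move=> i; rewrite mxE; exact: Z_ge0.
have uI0 (i : 'I_#|I|) : 0 < u (enum_val i) by [].
have cb i : continuous (b i) by exact: (continuous_loc_drive bmB q0).
have b0 i : 0 <= b i 0 by rewrite /b loc_drive0; exact: x0.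
have cl i : continuous (l i).
  have [cL _] := L_cont.
  by move=> s; apply: cvgB; [exact: (continuous_shift q0 (cL w _))|exact: cvg_cst].
have path_l i s : 0 <= s <= t - q -> sk_path (loc_Q Rm I) b l i s = Z (q + s) w (enum_val i) 0.
  move=> /andP[s0 st]; have qs0 : 0 <= q + s by exact: addr_ge0.
  rewrite (sk_pathE _ _ _ _ (C := submx_I I Rm)) //.
  rewrite /b /loc_drive max_l // !mxE !ZE // !mxE.
  have -> : \sum_j submx_I I Rm i j * l j s =
      \sum_k Rm (enum_val i) k * (L (q + s) w k 0 - L q w k 0).
    rewrite [RHS](bigID [in I]) /= [X in _ + X]big1 ?addr0 => [|k kI]; last first.
      rewrite (SRBM_flat (a := q)) ?subrr ?mulr0 // ?lerDl // => r /andP[qr rs].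
      by apply: Zpos => //; rewrite qr; lra.
    by rewrite [RHS]big_enum_val /=; apply: eq_bigr => j _; rewrite mxE /l max_l.
  under [X in _ + X]eq_bigr do rewrite mulrBr.
  by rewrite sumrB; ring.
have regE i : sk_reg (loc_Q Rm I) b i (t - q) = l i (t - q).
  have tq : 0 <= t - q <= t - q by rewrite lexx subr_ge0 qt.
  have Q0 := @loc_Q_ge0 _ _ Rm I Q_ge0.
  have ud := @loc_u_dom _ _ Rm u I Q_ge0 u_gt0 uE.
  have l0 j : l j 0 = 0 by rewrite /l maxxx addr0 subrr.
  have lnd j r s : 0 <= r -> r <= s -> l j r <= l j s.
    move=> r0 rs; rewrite lerD2r !max_l ?(le_trans r0 rs) //.
    by have [_ + _] := L_reg w (enum_val j); apply; [exact: addr_ge0|rewrite lerD2l].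
  have lge j r : 0 <= r <= t - q -> 0 <= sk_path (loc_Q Rm I) b l j r.
    by move=> rt; rewrite path_l //; apply: Z_ge0; case/andP: rt => r0 _; exact: addr_ge0.
  have lflat j : flat_off_zeros (sk_path (loc_Q Rm I) b l j) (l j) (t - q).
    move=> a c a0 ac ct pos; rewrite /l !max_l ?(le_trans a0 ac) //; congr (_ - _).
    apply: SRBM_flat; rewrite ?addr_ge0 ?lerD2l // => r /andP[ar rc].
    have := pos (r - q); rewrite path_l; last by apply/andP; split; lra.
    by rewrite [q + _]addrC subrK; apply; apply/andP; split; lra.
  have creg j : continuous (sk_reg (loc_Q Rm I) b j) := @continuous_sk_reg _ _ _ _ _ Q0 uI0 ud cb b0 j.
  have reg0 := sk_reg0 Q0 uI0 ud cb b0.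
  have regnd := sk_reg_nondecreasing Q0 uI0 ud cb b0.
  have regge := sk_reg_feasible Q0 uI0 ud cb b0.
  have regflat := sk_reg_flat Q0 uI0 ud cb b0.
  have l0' j : 0 <= l j 0 by rewrite l0.
  have reg0' j : 0 <= sk_reg (loc_Q Rm I) b j 0 by rewrite reg0.
  have lnd' j r s r0 rs (_ : s <= t - q) := lnd j r s r0 rs.
  have regnd' j r s r0 rs (_ : s <= t - q) := regnd j r s r0 rs.
  have regge' j r : 0 <= r <= t - q -> 0 <= sk_path (loc_Q Rm I) b (sk_reg (loc_Q Rm I) b) j r.
    by case/andP => r0 _; exact: regge.
  have regflat' j : flat_off_zeros (sk_path (loc_Q Rm I) b (sk_reg (loc_Q Rm I) b) j)
      (sk_reg (loc_Q Rm I) b j) (t - q).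
    by move=> a c a0 ac _; exact: regflat.
  have le1 := sk_minimal Q0 uI0 ud cb creg cl reg0 l0' lnd' regge' lge regflat'.
  have le2 := sk_minimal Q0 uI0 ud cb cl creg l0 reg0' regnd' lge regge' lflat.
  by apply/eqP; rewrite eq_le le1 // le2.
move=> i; have tq : 0 <= t - q <= t - q by rewrite lexx subr_ge0 qt.
have {2}-> : t = q + (t - q) by rewrite addrC subrK.
rewrite -path_l //.
rewrite /loc_Z /sk_path /sk_free -/b -/x.
by rewrite -!/(b _) regE; congr (_ - (_ + _)); apply: eq_bigr => j _; rewrite regE.
Qed.

(** With I the full zero set of Z(t), the finitely many other coordinates are positive on a common
    neighbourhood of t. Any positive rational q < t in it works, and the corner is hit at local time
    s = t - q. *)
Lemma face_hit_local w t (J : {set 'I_n}) : 0 < t -> face J (Z t w) ->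
  exists (I : {set 'I_n}) (q : rat), [/\ J \subset I, 0 <= ratr q :> R &
    exists2 s, 0 < s & forall i : 'I_#|I|,
      loc_Z B Rm (ratr q) (subvec I (Z (ratr q) w)) i s w = 0].
Proof.
move=> t0 [Zt ZJ]; pose I := [set i | Z t w i 0 == 0]%SET.
have JI : J \subset I by apply/fintype.subsetP => i iJ; rewrite inE ZJ.
have [cZ _] := Z_cont.
have : \forall s \near t, forall j, j \notin I -> 0 < Z (Num.max s 0) w j 0.
  apply: (@filter_forall R _ (fun j s => j \notin I -> 0 < Z (Num.max s 0) w j 0) (nbhs t)).
  move=> j; have [jI|jI] := boolP (j \in I); first exact: nearW.
  have Ztj : 0 < Z (Num.max t 0) w j 0.
    by rewrite max_l ?ltW // lt0r Zt andbT; move: jI; rewrite inE.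
  have /within_ge0_continuous cZj := cZ w j.
  have [e e0 he] := continuous_delta t cZj Ztj.
  apply/nbhs_ballP; exists e => //= s /he; rewrite ltr_norml => /andP[_] + _; lra.
move=> /nbhs_ballP[e /= e0 he].
have [|q] := @rat_in_itvoo R (Num.max 0 (t - e)) t; first by rewrite gt_max t0 /=; lra.
rewrite in_itv /= gt_max => /andP[/andP[q0 qe] qt].
exists I, q; split=> //; first exact: ltW.
exists (t - ratr q) => [|i]; first by rewrite subr_gt0.
rewrite loc_Z_eq ?ltW // => [|j r jI /andP[qr rt]].
  by have := enum_valP i; rewrite inE => /eqP.
have r0 : 0 <= r by apply: le_trans qr; exact: ltW.
have := he r _ j jI; rewrite max_l //; apply.
by rewrite /ball /= ger0_norm ?subr_ge0 //; lra.
Qed.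
End FaceHittingPath.

(** * Union over the countably many local events *)

Theorem theorem3p6 (R : realType) (d : nat) (mu : 'cV[R]_d) (A : 'M[R]_d)
  (Rm : 'M[R]_d) (J : {set 'I_d}) :
  (1 <= d)%N -> sym_pos_def A -> reflection_M_matrix Rm -> (0 < #|J|)%N ->
  (forall I : {set 'I_d}, J \subset I ->
     SRBM_not_hit_corner (submx_I I Rm) (subvec I mu) (submx_I I A)) ->
  SRBM_not_hit Rm mu A J.
Proof.
move=> _ _ MR _ nohit dT T P F Z z filtF _ [B [L [bmB cZ Z0 ZE [cL Lreg]]]].
have [u [u0 uE]] := reflection_M_matrix_weight MR.
have Q0 i j : 0 <= (1%:M - Rm) i j.
  have [diag off _] := MR; rewrite !mxE; have [->|ij] := eqVneq i j.
    by rewrite diag subrr.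
  by rewrite sub0r oppr_ge0 off.
(* The constraints on I and q belong to the event, so the union runs over all pairs; a pair
   violating them contributes the empty set. *)
pose N (k : {set 'I_d} * rat) := [set w | [/\ J \subset k.1, 0 <= ratr k.2 :> R &
  exists2 s, 0 < s & forall i : 'I_#|k.1|,
    loc_Z B Rm (ratr k.2) (subvec k.1 (Z (ratr k.2) w)) i s w = 0]].
apply: (@negligibleS _ _ _ _ [set w | exists k, N k w]).
  move=> w [t [t0 Zt]].
  have [I [q h]] := face_hit_local bmB Q0 u0 uE cZ Z0 ZE cL Lreg t0 Zt.
  by exists (I, q).
apply: negligible_countable => -[I q]; rewrite /N /=.
have [JI|nJI] := boolP (J \subset I); last first.
  by apply: (@negligibleS _ _ _ _ set0) => [w []|]; last exact: negligible_set0.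
have [q0|q0] := leP 0 (ratr q : R); last first.
  by apply: (@negligibleS _ _ _ _ set0) => [w []|]; last exact: negligible_set0.
have Xorth w : orthant (subvec I (Z (ratr q) w)).
  by move=> i; rewrite mxE; exact: Z0.
have mX i : measurable_wrt (F (ratr q)) (fun w => subvec I (Z (ratr q) w) i 0).
  have [_ mZ] := cZ; have := mZ (ratr q) (enum_val i) q0.
  by congr measurable_wrt; apply/funext => w; rewrite mxE.
apply: negligibleS (loc_Z_random_start_negligible filtF bmB q0 Q0 u0 uE Xorth mX (nohit I JI)).
by move=> w [].
Qed.
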